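(* Let $k\ge 3$ be an integer and let $$H(k)=\{w\in W(k)\mid \rho(w)-1\in 3^{4k}\mathcal R\}.$$ Then $H(k)$ is a normal subgroup of $W(k)$ contained in $W(k)^+$. Moreover, (1) $B_{4k}\cap H(k)=\{1\}$, where $B_{4k}=\{w\in W(k)\mid l(w)\le 4k\}$; and (2) $\mathrm{Card}\,W(k)/H(k)\le 3^{72k\phi(2k)}$, where $\phi$ is the Euler totient function.
   Context: $W(k)$ is the Coxeter group $\langle (s_i)_{i\in\mathbb Z/6\mathbb Z}\mid s_i^2=1,\ (s_is_{i+1})^2=1,\ (s_is_{i+2})^k=1\ \forall i\in\mathbb Z/6\mathbb Z\rangle$, $l$ is its word length with respect to the generators $s_i$, $\epsilon:W(k)\to\{\pm1\}$ is the homomorphism with $\epsilon(s_i)=-1$ for all $i$, and $W(k)^+=\ker\epsilon$. Let $K=\mathbb Q(\cos(\pi/k))$ with ring of integers $\mathcal O$. Let $(\alpha_i)_{i\in\mathbb Z/6\mathbb Z}$ be a basis of $K^6$ and let $B$ be the symmetric bilinear form on $K^6$ with $B(\alpha_i,\alpha_i)=2$, $B(\alpha_i,\alpha_j)=0$ if $i-j=\pm1$, $B(\alpha_i,\alpha_j)=-2\cos(\pi/k)$ if $i-j=\pm2$, and $B(\alpha_i,\alpha_j)=-2$ if $i-j=3$. The Tits representation $\rho:W(k)\to \mathrm{GL}_6(K)$ is the homomorphism defined by $\rho(s_i)(\lambda)=\lambda-B(\alpha_i,\lambda)\alpha_i$. For $i,j\in\mathbb Z/6\mathbb Z$ let $E_{i,j}\in\mathrm{End}(K^6)$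 be $v\mapsto B(\alpha_j,v)\alpha_i$; these form a $K$-basis of $\mathrm{End}(K^6)$. Put $\mathcal R=\bigoplus_{i,j\in\mathbb Z/6\mathbb Z}\mathcal O\,E_{i,j}$. *)

(* Defs.v *)
From HB Require Import structures.
From mathcomp Require Import all_boot all_order all_algebra.
From mathcomp Require Import all_classical all_reals all_analysis.
From mathcomp Require Import ring lra.

Set Implicit Arguments.
Unset Strict Implicit.
Unset Printing Implicit Defensive.

Import Order.TTheory GRing.Theory Num.Theory.
Local Open Scope quotient_scope.
Local Open Scope classical_set_scope.
Local Open Scope ring_scope.

Section CoxeterGroup.
Variable k : nat.

Definition is_relator (r : seq 'Z_6) : Prop :=
  exists i : 'Z_6,
    [\/ r = [:: i; i],
        r = flatten (nseq 2 [:: i; i + 1])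
      | r = flatten (nseq k [:: i; i + 2])].

(* The least congruence on words identifying the relators with the empty word.
   Since s_i^2 = 1 is a relation, words in the s_i (without formal inverses)
   suffice; the universal property of the presented group is proved below
   (cox_lift_gen, cox_liftM, cox_lift_unique). *)
Inductive cox_cong : seq 'Z_6 -> seq 'Z_6 -> Prop :=
| cox_rel u r v of is_relator r : cox_cong (u ++ r ++ v) (u ++ v)
| cox_refl u : cox_cong u u
| cox_sym u v of cox_cong u v : cox_cong v u
| cox_trans u v w of cox_cong u v & cox_cong v w : cox_cong u w.

Definition cox_congb : rel (seq 'Z_6) := fun u v => `[< cox_cong u v >].

Lemma cox_congb_equiv : equiv_class_of cox_congb.
Proof.
split=> [u|u v|v u w].
- by apply/asboolP; exact: cox_refl.
- by apply/asboolP/asboolP; exact: cox_sym.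
- by move=> /asboolP uv /asboolP vw; apply/asboolP; exact: cox_trans uv vw.
Qed.

Canonical cox_equiv := EquivRelPack cox_congb_equiv.

Definition cox := {eq_quot cox_equiv}.
HB.instance Definition _ := Choice.on cox.
HB.instance Definition _ := EqQuotient.on cox.

Definition cox_of_word (u : seq 'Z_6) : cox := \pi_cox u.

Lemma cox_of_wordP u v : cox_of_word u = cox_of_word v <-> cox_cong u v.
Proof.
rewrite /cox_of_word; split=> [/eqmodP/asboolP//|uv].
by apply/eqmodP/asboolP.
Qed.

Lemma repr_cox u : cox_cong (repr (cox_of_word u)) u.
Proof. by apply/cox_of_wordP; rewrite /cox_of_word reprK. Qed.

Lemma cox_cong_cat x y u v : cox_cong u v -> cox_cong (x ++ u ++ y) (x ++ v ++ y).
Proof.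
elim=> {u v} [u r v rP|u|u v _|u v w _ uv _ vw].
- rewrite -!catA catA (catA x u (v ++ y)); exact: cox_rel.
- exact: cox_refl.
- exact: cox_sym.
- exact: cox_trans uv vw.
Qed.

Lemma cox_cong_cat2 u u' v v' :
  cox_cong u u' -> cox_cong v v' -> cox_cong (u ++ v) (u' ++ v').
Proof.
move=> uu' vv'; apply: (@cox_trans _ (u' ++ v)).
  by have := cox_cong_cat [::] v uu'.
by have := cox_cong_cat u' [::] vv'; rewrite !cats0.
Qed.

Lemma cox_cong_revK u : cox_cong (rev u ++ u) [::].
Proof.
elim: u => [|i u IHu]; first exact: cox_refl.
rewrite rev_cons cat_rcons; apply: cox_trans IHu.
by apply: (@cox_rel (rev u) [:: i; i] u); exists i; constructor.
Qed.

Lemma cox_cong_rev u v : cox_cong u v -> cox_cong (rev u) (rev v).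
Proof.
move=> uv; apply: (@cox_trans _ (rev u ++ (v ++ rev v))).
  rewrite -{1}[rev u]cats0; apply: cox_cong_cat2; first exact: cox_refl.
  by apply: cox_sym; have := cox_cong_revK (rev v); rewrite revK.
rewrite catA -{2}[rev v]cat0s; apply: cox_cong_cat2; last exact: cox_refl.
apply: cox_trans (cox_cong_revK u).
by apply: cox_cong_cat2; [exact: cox_refl|exact: cox_sym].
Qed.

Definition cox_one := cox_of_word [::].
Definition cox_mul (x y : cox) := cox_of_word (repr x ++ repr y).
Definition cox_inv (x : cox) := cox_of_word (rev (repr x)).

Lemma cox_of_word_cat u v :
  cox_mul (cox_of_word u) (cox_of_word v) = cox_of_word (u ++ v).
Proof. by apply/cox_of_wordP; apply: cox_cong_cat2; exact: repr_cox. Qed.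

Lemma cox_ofK x : cox_of_word (repr x) = x.
Proof. exact: reprK. Qed.

Lemma cox_mulA : associative cox_mul.
Proof.
move=> x y z; rewrite -(cox_ofK x) -(cox_ofK y) -(cox_ofK z).
by rewrite !cox_of_word_cat catA.
Qed.

Lemma cox_mul1 : left_id cox_one cox_mul.
Proof. by move=> x; rewrite -(cox_ofK x) cox_of_word_cat. Qed.

Lemma cox_mulV : left_inverse cox_one cox_inv cox_mul.
Proof.
move=> x; rewrite -{2}(cox_ofK x) cox_of_word_cat.
by apply/cox_of_wordP; exact: cox_cong_revK.
Qed.

Lemma cox_mulr1 : right_id cox_one cox_mul.
Proof. by move=> x; rewrite -(cox_ofK x) cox_of_word_cat cats0. Qed.

Lemma cox_mulrV : right_inverse cox_one cox_inv cox_mul.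
Proof.
move=> x; rewrite -{1}(cox_ofK x) cox_of_word_cat.
apply/cox_of_wordP.
by have := cox_cong_revK (rev (repr x)); rewrite revK.
Qed.

HB.instance Definition _ := isGroup.Build cox
  cox_mulA cox_mul1 cox_mulr1 cox_mulV cox_mulrV.

Definition cox_gen (i : 'Z_6) : cox := cox_of_word [:: i].

Lemma cox_word_prod u : (\prod_(i <- u) cox_gen i)%g = cox_of_word u.
Proof.
elim: u => [|i u IHu]; first by rewrite big_nil.
by rewrite big_cons IHu [LHS]cox_of_word_cat.
Qed.

Section Lift.
Variables (T : Type) (idx : T) (op : Monoid.law idx) (f : 'Z_6 -> T).

Definition cox_lift (w : cox) : T := \big[op/idx]_(i <- repr w) f i.

Definition respects_relators :=
  forall r, is_relator r -> \big[op/idx]_(i <- r) f i = idx.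

Hypothesis fP : respects_relators.

Lemma cox_lift_cong u v :
  cox_cong u v -> \big[op/idx]_(i <- u) f i = \big[op/idx]_(i <- v) f i.
Proof.
elim=> // {u v} [u r v rP|u v w _ -> _ -> //].
by rewrite !big_cat /= (fP rP) Monoid.mul1m.
Qed.

Lemma cox_lift_word u : cox_lift (cox_of_word u) = \big[op/idx]_(i <- u) f i.
Proof. exact/cox_lift_cong/repr_cox. Qed.

Lemma cox_lift_gen i : cox_lift (cox_gen i) = f i.
Proof. by rewrite cox_lift_word big_seq1. Qed.

Lemma cox_lift1 : cox_lift 1%g = idx.
Proof. by rewrite cox_lift_word big_nil. Qed.

Lemma cox_liftM x y : cox_lift (x * y)%g = op (cox_lift x) (cox_lift y).
Proof. by rewrite -[(x * y)%g]/(cox_mul x y) cox_lift_word big_cat. Qed.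

Lemma cox_lift_unique (g : cox -> T) : g 1%g = idx ->
  (forall x y, g (x * y)%g = op (g x) (g y)) ->
  (forall i, g (cox_gen i) = f i) -> g =1 cox_lift.
Proof.
move=> g1 gM gf x; rewrite -(cox_ofK x) -cox_word_prod cox_word_prod.
rewrite cox_lift_word -cox_word_prod.
elim: (repr x) => [|i u IHu]; first by rewrite !big_nil.
by rewrite !big_cons gM gf IHu.
Qed.
End Lift.

Lemma cox_gen_relator r : is_relator r -> (\prod_(i <- r) cox_gen i)%g = 1%g.
Proof.
move=> rP; rewrite cox_word_prod; apply/cox_of_wordP.
by have := cox_rel [::] [::] rP; rewrite cats0.
Qed.

Lemma cox_word_ex (w : cox) :
  exists n, `[< exists u : seq 'Z_6, size u = n /\ (\prod_(i <- u) cox_gen i)%g = w >].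
Proof.
exists (size (repr w)); apply/asboolP; exists (repr w); split=> //.
by rewrite cox_word_prod cox_ofK.
Qed.

Definition cox_length (w : cox) : nat := ex_minn (cox_word_ex w).

Definition cox_ball (n : nat) : set cox := [set w | (cox_length w <= n)%N].

Definition cox_sign : cox -> int := cox_lift (@GRing.mul int) (fun=> -1).

Lemma cox_sign_relators : respects_relators (@GRing.mul int) (fun=> -1).
Proof.
move=> r [i rP]; rewrite big_const_seq count_predT iter_mulr_1 -signr_odd.
suff -> : odd (size r) = false by [].
case: rP => -> //; elim: k => //= n IHn; by rewrite IHn.
Qed.

Lemma cox_sign_gen i : cox_sign (cox_gen i) = -1.
Proof. exact: (cox_lift_gen cox_sign_relators). Qed.

Lemma cox_signM x y : cox_sign (x * y)%g = cox_sign x * cox_sign y.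
Proof. exact: (cox_liftM cox_sign_relators). Qed.

Definition cox_even : set cox := [set w | cox_sign w = 1].

End CoxeterGroup.

Arguments cox_even k : clear implicits.
Arguments cox_ball k n : clear implicits.

Definition normal_subgroup (G : groupType) (H : set G) : Prop :=
  [/\ H 1%g,
      forall x y, H x -> H y -> H (x * y)%g,
      forall x, H x -> H x^-1%g
    & forall g x, H x -> H (x ^ g)%g].

Definition left_cosets (G : groupType) (H : set G) : set (set G) :=
  [set [set (g * h)%g | h in H] | g in [set: G]].

Lemma cramer2 (F : fieldType) (x y b d : F) : d = 4 - b ^+ 2 -> d != 0 ->
  x + - ((2 * x - b * y) / d) * 2 + - ((2 * y - b * x) / d) * b = 0.
Proof. by move=> dE d0; rewrite dE in d0 *; field. Qed.

Section CosField.
Variables (R : realType) (k : nat).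

Definition cospik : R := cos (pi / k%:R).

(* Q(cos(pi/k)): the least subfield of R containing cos(pi/k). *)
Definition in_cosfield : {pred R} := fun x =>
  `[< forall S : {pred R}, divring_closed S -> cospik \in S -> x \in S >].

Lemma in_cosfield_closed : divring_closed in_cosfield.
Proof.
split=> [|x y /asboolP Kx /asboolP Ky|x y /asboolP Kx /asboolP Ky];
  apply/asboolP => S SP cS; case: (SP) => S1 SB SV //.
- by apply: SB; [exact: Kx|exact: Ky].
- by apply: SV; [exact: Kx|exact: Ky].
Qed.

HB.instance Definition _ :=
  GRing.isDivringClosed.Build R in_cosfield in_cosfield_closed.

Definition cosfield := {x : R | in_cosfield x}.
HB.instance Definition _ := SubChoice.on cosfield.
HB.instance Definition _ := [SubChoice_isSubIntegralDomain of cosfield by <:].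
HB.instance Definition _ := [SubIntegralDomain_isSubField of cosfield by <:].

Lemma cospik_in : in_cosfield cospik.
Proof. by apply/asboolP. Qed.

Definition cosK : cosfield := exist _ cospik cospik_in.

Definition cosint : set cosfield := [set x | integralOver (intr : int -> cosfield) x].

Definition gram (i j : 'Z_6) : cosfield :=
  if i - j == 0 then 2
  else if (i - j == 1) || (i - j == -1) then 0
  else if (i - j == 2) || (i - j == -2) then - 2 * cosK
  else - 2.

Section Tits.
Variable alpha : 6.-tuple 'cV[cosfield]_6.
Local Notation V := 'cV[cosfield]_6.
Local Notation a_ := (tnth alpha).

(* The bilinear form whose Gram matrix in the basis alpha is gram. *)
Definition tits_form (u v : V) : cosfield :=
  \sum_(i < 6) \sum_(j < 6) coord alpha i u * coord alpha j v * gram i j.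

(* linfun f : 'End(V) is the endomorphism f when f is linear, as is the case
   here (tits_EE, tits_reflE). *)
Definition tits_E (i j : 'Z_6) : 'End(V) :=
  linfun (fun v => tits_form (a_ j) v *: a_ i).

Definition tits_refl (i : 'Z_6) : 'End(V) :=
  linfun (fun v => v - tits_form (a_ i) v *: a_ i).

HB.instance Definition _ := Monoid.isLaw.Build 'End(V) (\1)%VF (@comp_lfun _ V V V)
  (@comp_lfunA _ V V V V) (@comp_lfun1l _ V V) (@comp_lfun1r _ V V).

(* The homomorphism with tits_rep (cox_gen k i) = tits_refl i, for a basis alpha
   and 2 < k: see tits_rep_gen, tits_rep1 and tits_repM. *)
Definition tits_rep : cox k -> 'End(V) :=
  cox_lift (@comp_lfun _ V V V) tits_refl.

Definition tits_lattice : set 'End(V) :=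
  [set f | exists c : 'Z_6 -> 'Z_6 -> cosfield,
     (forall i j, cosint (c i j)) /\ f = \sum_i \sum_j c i j *: tits_E i j].

Definition tits_congruence (n : nat) : set (cox k) :=
  [set w | exists2 f, tits_lattice f & tits_rep w - (\1)%VF = 3 ^+ n *: f].

Lemma gramC i j : gram i j = gram j i.
Proof.
rewrite /gram -[j - i]opprB !eqr_oppLR oppr0 !opprK.
by rewrite (orbC (i - j == -1)) (orbC (i - j == -2)).
Qed.

Lemma gramii i : gram i i = 2.
Proof. by rewrite /gram subrr. Qed.

Lemma gram1 i : gram i (i + 1) = 0.
Proof. by rewrite /gram opprD addrA subrr sub0r. Qed.

Lemma gram2 i : gram i (i + 2) = - 2 * cosK.
Proof. by rewrite /gram opprD addrA subrr sub0r. Qed.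

Lemma tits_formC u v : tits_form u v = tits_form v u.
Proof.
rewrite /tits_form exchange_big; apply: eq_bigr => i _; apply: eq_bigr => j _.
by rewrite gramC (mulrC (coord _ _ u)).
Qed.

Lemma tits_form_linear u : scalar (tits_form u).
Proof.
move=> c v w; rewrite /tits_form mulr_sumr -big_split; apply: eq_bigr => i _.
rewrite mulr_sumr -big_split; apply: eq_bigr => j _ /=.
by rewrite linearP /=; ring.
Qed.

Lemma linfun_linear (f : V -> V) : linear f -> linfun f =1 f.
Proof.
move=> lf; pose g : {linear V -> V} :=
  HB.pack f (GRing.isLinear.Build _ _ _ _ f lf).
exact: (lfunE g).
Qed.

Lemma tits_EE i j v : tits_E i j v = tits_form (a_ j) v *: a_ i.
Proof.
apply: linfun_linear => c u w.
by rewrite tits_form_linear scalerDl scalerA.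
Qed.

Lemma tits_reflE i v : tits_refl i v = v - tits_form (a_ i) v *: a_ i.
Proof.
apply: linfun_linear => c u w.
by rewrite tits_form_linear scalerDl -scalerA scalerBr opprD addrACA.
Qed.

Hypothesis alphaP : basis_of fullv alpha.

Lemma coord_alpha (i j : 'I_6) : coord alpha i (a_ j) = (j == i)%:R.
Proof. by rewrite (tnth_nth 0) coord_free ?(basis_free alphaP) // eq_sym. Qed.

Lemma tits_form_basis i j : tits_form (a_ i) (a_ j) = gram i j.
Proof.
rewrite /tits_form (bigD1 (i : 'I_6)) //= (bigD1 (j : 'I_6)) //= !coord_alpha.
rewrite !eqxx !mul1r big1 ?addr0 => [|l lj].
  rewrite big1 ?addr0 // => l li; apply: big1 => m _.
  by rewrite coord_alpha eq_sym (negbTE li) !mul0r.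
by rewrite coord_alpha [j == l]eq_sym (negbTE lj) mulr0 mul0r.
Qed.

Local Notation B := tits_form.

Let BD u v w : B u (v + w) = B u v + B u w.
Proof. by have := tits_form_linear u 1 v w; rewrite scale1r mul1r. Qed.

Let BZ u c v : B u (c *: v) = c * B u v.
Proof.
have := tits_form_linear u c v (- (c *: v)); rewrite subrr.
have B0 : B u 0 = 0.
  by have := BD u 0 0; rewrite addr0 -{1}[B u 0]addr0 => /addrI <-.
rewrite B0 -scaleNr => /esym/eqP; rewrite addr_eq0 => /eqP ->.
have := BD u (c *: v) (- c *: v); rewrite -scalerDl subrr scale0r B0.
by move=> /esym/eqP; rewrite addr_eq0 => /eqP ->.
Qed.

Let r_ i v := v - B (a_ i) v *: a_ i.

Let B0P i j (v0 : V) p q : B (a_ i) v0 = 0 ->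
  B (a_ i) (v0 + p *: a_ i + q *: a_ j) = 2 * p + gram i j * q.
Proof.
by move=> h; rewrite !BD !BZ !tits_form_basis gramii h add0r mulrC [q * _]mulrC.
Qed.

Let rP i j (v0 : V) p q : B (a_ i) v0 = 0 ->
  r_ i (v0 + p *: a_ i + q *: a_ j)
    = v0 + (- p - gram i j * q) *: a_ i + q *: a_ j.
Proof.
move=> h; rewrite /r_ B0P //; apply/matrixP => l m; rewrite !mxE; ring.
Qed.

Let splitP i j v : 4 - gram i j ^+ 2 != 0 ->
  exists v0 p q, [/\ B (a_ i) v0 = 0, B (a_ j) v0 = 0
    & v = v0 + p *: a_ i + q *: a_ j].
Proof.
set b := gram i j => bP; set x := B (a_ i) v; set y := B (a_ j) v.
pose p := (2 * x - b * y) / (4 - b ^+ 2).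
pose q := (2 * y - b * x) / (4 - b ^+ 2).
exists (v + (- p) *: a_ i + (- q) *: a_ j), p, q; split.
- by rewrite !BD !BZ !tits_form_basis gramii -/b -/x cramer2.
- rewrite !BD !BZ !tits_form_basis gramii gramC -/b -/y addrAC.
  exact: cramer2.
- by rewrite !scaleNr addrAC !subrK.
Qed.

Let r_pairP i j n (z : nat -> cosfield) v0 :
  B (a_ i) v0 = 0 -> B (a_ j) v0 = 0 ->
  (forall m, z m.+2 = - gram i j * z m.+1 - z m) ->
  iter n (fun v => r_ i (r_ j v)) (v0 + z 1%N *: a_ i + z 0%N *: a_ j)
   = v0 + z n.*2.+1 *: a_ i + z n.*2 *: a_ j.
Proof.
move=> hi hj zP; elim: n => [|n IHn] //=; rewrite IHn.
rewrite [v0 + _ + _]addrAC rP // addrAC rP //.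
have e2 : - z n.*2 - gram j i * z n.*2.+1 = z n.*2.+2.
  by rewrite zP gramC; ring.
have e3 : - z n.*2.+1 - gram i j * z n.*2.+2 = z n.*2.+3.
  by rewrite [in RHS]zP; ring.
by rewrite e2 e3.
Qed.

Fixpoint cheb n : cosfield :=
  if n is n'.+1 then if n' is n''.+1 then 2 * cosK * cheb n' - cheb n'' else 1
  else 0.

Let chebSS n : cheb n.+2 = 2 * cosK * cheb n.+1 - cheb n.
Proof. by []. Qed.

Let val_cheb n : val (cheb n) * sin (pi / k%:R) = sin (n%:R * (pi / k%:R)).
Proof.
set t := pi / k%:R; suff: val (cheb n) * sin t = sin (n%:R * t) /\
  val (cheb n.+1) * sin t = sin (n.+1%:R * t) by case.
elim: n => [|n [IH0 IH1]]; first by rewrite !mul0r sin0 !mul1r.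
split=> //.
have -> : val (cheb n.+2) = 2 * cos t * val (cheb n.+1) - val (cheb n).
  by rewrite chebSS rmorphB !rmorphM rmorph_nat.
rewrite mulrBl -!mulrA IH0 IH1.
have -> : n.+2%:R * t = n.+1%:R * t + t by rewrite -natr1 mulrDl mul1r.
have -> : n%:R * t = n.+1%:R * t - t by rewrite -natr1 mulrDl mul1r addrK.
rewrite sinB sinD; ring.
Qed.

Hypothesis k_gt2 : (2 < k)%N.

Let k_neq0 : k%:R != 0 :> R.
Proof. by rewrite pnatr_eq0; case: k k_gt2. Qed.

Let sin_neq0 : sin (pi / k%:R) != 0 :> R.
Proof.
apply: lt0r_neq0; apply: sin_gt0_pi; rewrite divr_gt0 ?pi_gt0 ?ltr0n //=.
  rewrite ltr_pdivrMr ?ltr0n; last exact: ltn_trans k_gt2.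
  by rewrite ltr_pMr ?pi_gt0 // ltr1n (ltn_trans _ k_gt2).
exact: ltn_trans k_gt2.
Qed.

Let cheb2k : cheb k.*2 = 0.
Proof.
apply: val_inj; apply: (mulIf sin_neq0); rewrite val_cheb -muln2 natrM.
have -> : k%:R * 2 * (pi / k%:R) = pi *+ 2 :> R by rewrite -mulr_natl; field.
by rewrite sin_mulr2n sinpi mulr0 mul0rn mul0r.
Qed.

Let cheb2kS : cheb k.*2.+1 = 1.
Proof.
apply: val_inj; apply: (mulIf sin_neq0); rewrite val_cheb -muln2 -natr1 natrM.
have -> : (k%:R * 2 + 1) * (pi / k%:R) = pi / k%:R + pi *+ 2 :> R.
  by rewrite -mulr_natl; field.
by rewrite sinD2pi mul1r.
Qed.

Let gram2_neq0 i : 4 - gram i (i + 2) ^+ 2 != 0.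
Proof.
apply: contra sin_neq0 => /eqP/(congr1 val); rewrite gram2.
have -> : val (4 - (- 2 * cosK) ^+ 2) = 4 - (- 2 * cospik) ^+ 2.
  by rewrite rmorphB rmorphXn rmorphM rmorphN !rmorph_nat.
rewrite /cospik => e; rewrite -sqrf_eq0; apply/eqP.
have := cos2Dsin2 (pi / k%:R : R); move: e => /=; lra.
Qed.

Let iter_prod (i j : 'Z_6) n v :
  (\big[(@comp_lfun _ V V V)/(\1)%VF]_(l <- flatten (nseq n [:: i; j]))
     tits_refl l) v = iter n (fun v => r_ i (r_ j v)) v.
Proof.
elim: n => [|n IHn] /=; first by rewrite big_nil lfunE.
by rewrite !big_cons !comp_lfunE !tits_reflE IHn.
Qed.

Lemma tits_refl_relators :
  respects_relators k (@comp_lfun _ V V V) tits_refl.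
Proof.
move=> r [i rP']; apply/lfunP => v; rewrite lfunE /=.
case: rP' => ->.
- rewrite !big_cons big_nil !comp_lfunE lfunE /= !tits_reflE.
  rewrite -scaleNr BD BZ tits_form_basis gramii.
  apply/matrixP => l m; rewrite !mxE; ring.
- rewrite iter_prod.
  have h : 4 - gram i (i + 1) ^+ 2 != 0.
    rewrite gram1 expr0n subr0; apply/eqP => /(congr1 val)/eqP.
    by rewrite rmorph_nat pnatr_eq0.
  have [v0 [p [q [hi hj ->]]]] := splitP v h.
  pose z n := (-1) ^+ n./2 * (if odd n then p else q).
  have := r_pairP 2 hi hj (z := z); rewrite /z /= !expr0 !mul1r => ->.
    by rewrite sqrrN expr1n !mul1r.
  by move=> m /=; rewrite negbK gram1 oppr0 mul0r sub0r exprS mulN1r mulNr.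
- rewrite iter_prod.
  have [v0 [p [q [hi hj ->]]]] := splitP v (gram2_neq0 i).
  pose z n := p * cheb n + q * (cheb n.+1 - 2 * cosK * cheb n).
  have zP m : z m.+2 = - gram i (i + 2) * z m.+1 - z m.
    rewrite gram2 /z !chebSS; ring.
  have z0 : z 0%N = q by rewrite /z [cheb 0]/= [cheb 1]/=; ring.
  have z1 : z 1%N = p by rewrite /z chebSS [cheb 0]/= [cheb 1]/=; ring.
  have z2k : z k.*2 = q by rewrite /z cheb2kS cheb2k; ring.
  have z2kS : z k.*2.+1 = p by rewrite /z chebSS cheb2kS cheb2k; ring.
  by have := r_pairP k hi hj zP; rewrite z0 z1 z2k z2kS.
Qed.

Lemma tits_rep_gen i v :
  tits_rep (cox_gen k i) v = v - tits_form (a_ i) v *: a_ i.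
Proof. by rewrite /tits_rep (cox_lift_gen tits_refl_relators) tits_reflE. Qed.

Lemma tits_rep1 : tits_rep 1%g = (\1)%VF.
Proof. exact: (cox_lift1 tits_refl_relators). Qed.

Lemma tits_repM x y : tits_rep (x * y)%g = (tits_rep x \o tits_rep y)%VF.
Proof. exact: (cox_liftM tits_refl_relators). Qed.

End Tits.
End CosField.

(* Main.v *)
Require Import Defs.
From HB Require Import structures.
From mathcomp Require Import all_boot all_order all_algebra all_field.
From mathcomp Require Import all_classical all_reals all_analysis.
From mathcomp Require Import perm complex zify ring lra.

(* Write G for the Gram matrix of B and theta = 2 cos (pi / k). Since
   E_(i,j) E_(a,b) = B(alpha_j, alpha_a) E_(i,b), the matrix of rho(w) in the basis
   alpha is 1 + C_w G with C_w a matrix over Z[theta], and 1 + 3^n R is stable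
   under products; this gives normality, and det rho(w) = epsilon(w) = 1 mod 3
   gives evenness.

   If w has length at most n, an induction on a reduced word bounds every
   conjugate of every entry of C_w by (3^n - 1) / 2. When w lies in the congruence
   subgroup of level n, such an entry is 3^n times an algebraic integer all of
   whose conjugates have absolute value < 1, so its norm vanishes: rho(w) = 1, and
   w = 1 because the Tits representation is faithful.

   The class of w is determined by C_w modulo 3^n Z[theta], and theta is a root of a
   monic integer polynomial of degree phi(2k) / 2, so there are at most
   3^(36 n phi(2k) / 2) classes. *)

Set Implicit Arguments.
Unset Strict Implicit.
Unset Printing Implicit Defensive.

Import Order.TTheory GRing.Theory Num.Theory.
Local Open Scope classical_set_scope.
Local Open Scope card_scope.
Local Open Scope ring_scope.

(** * Cyclotomic integers *)

Lemma map_ratr_intr (F : numFieldType) (p : {poly int}) :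
  map_poly (ratr : rat -> F) (map_poly intr p) = map_poly intr p.
Proof. by rewrite -map_poly_comp; apply: eq_map_poly => a; rewrite /= ratr_int. Qed.

(** [X^n - 1] is the product of the ['Phi_d] over d | n, so z is a root of some ['Phi_d]. That
    factor divides [X^d - 1], hence z^d = 1 and n divides d. *)
Lemma root_Cyclotomic (F : fieldType) n (z : F) :
  n.-primitive_root z -> root (map_poly intr 'Phi_n) z.
Proof.
move=> prim_z; have n_gt0 := prim_order_gt0 prim_z.
have: (map_poly intr (\prod_(d <- divisors n) 'Phi_d)).[z] == 0.
  rewrite prod_Cyclotomic // rmorphB rmorph1 /= map_polyXn.
  by rewrite !hornerE prim_expr_order // subrr.
rewrite rmorph_prod horner_prod prodf_seq_eq0 => /hasP[d].
rewrite -dvdn_divisors //= => d_n zd; suff <- : d = n by [].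
have d_gt0 := dvdn_gt0 n_gt0 d_n.
apply/eqP; rewrite eqn_dvd d_n (prim_order_dvd prim_z) /=.
have: map_poly (intr : int -> F) ('X^d - 1) = 'X^d - 1.
  by rewrite rmorphB rmorph1 /= map_polyXn.
rewrite -prod_Cyclotomic // (big_rem d) ?divisors_id //= rmorphM.
move=> /(congr1 (fun p => p.[z])); rewrite hornerM (eqP zd) mul0r !hornerE.
by move/esym/eqP; rewrite subr_eq0.
Qed.

(** Irreducibility of ['Phi_n] over Q, transported from [algC]: the gcd of g and ['Phi_n] has the
    root z, so it is not constant and has a root in [algC]; that root is a primitive n-th root of
    unity, with minimal polynomial ['Phi_n]. *)
Lemma Cyclotomic_dvdp (F : numFieldType) n (z : F) (g : {poly rat}) :
  n.-primitive_root z -> root (map_poly ratr g) z -> map_poly intr 'Phi_n %| g.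
Proof.
move=> prim_z gz; have n_gt0 := prim_order_gt0 prim_z.
set Phi := map_poly _ _; set h := gcdp g Phi.
have hz : root (map_poly ratr h) z.
  by rewrite gcdp_map root_gcd gz /Phi map_ratr_intr root_Cyclotomic.
have [w hw] : exists w, root (map_poly (ratr : rat -> algC) h) w.
  apply/closed_rootP; rewrite size_map_poly; apply/eqP => /eqP sh.
  have /size_poly1P[c c0 hE] : size h == 1%N by [].
  by move: hz; rewrite hE map_polyC rootC fmorph_eq0 (negbTE c0).
have [z0 prim_z0] := C_prim_root_exists n_gt0.
have prim_w : n.-primitive_root w.
  rewrite -(root_cyclotomic prim_z0) -(Cintr_Cyclotomic prim_z0) -map_ratr_intr.
  by move: hw; rewrite gcdp_map root_gcd => /andP[].
have [p [pE _] pP] := minCpolyP w.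
have -> : Phi = p.
  apply: (map_poly_inj (ratr : {rmorphism rat -> algC})).
  by rewrite -pE (minCpoly_cyclotomic prim_w) -(Cintr_Cyclotomic prim_w) map_ratr_intr.
by apply: dvdp_trans (dvdp_gcdl g Phi); rewrite -pP.
Qed.

(* The product is the determinant of multiplication by q on Z[X]/(f), which the
   Vandermonde matrix of the roots diagonalises. *)
Lemma prod_horner_roots_int (F : fieldType) d (f q : {poly int}) (a : 'I_d -> F) :
  f \is monic -> size f = d.+1 -> injective a ->
  (forall i, root (map_poly intr f) (a i)) ->
  exists N : int, \prod_i (map_poly intr q).[a i] = N%:~R.
Proof.
move=> fm fs aI fa.
pose r i := Pdiv.Ring.rmodp (q * 'X^i) f.
pose A : 'M[int]_d := \matrix_(i, j) (r i)`_j.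
pose V := @Vandermonde F d d (\row_i a i).
have qV : map_mx intr A *m V = V *m diag_mx (\row_i (map_poly intr q).[a i]).
  apply/matrixP => i l; rewrite mul_mx_diag !mxE.
  under eq_bigr do rewrite !mxE.
  have -> : \sum_(j < d) ((r i)`_j)%:~R * a l ^+ j = (map_poly intr (r i)).[a l].
    rewrite (@horner_coef_wide _ d).
      by apply: eq_bigr => j _; rewrite coef_map.
    apply: leq_trans (size_poly _ _) _.
    by rewrite -ltnS -fs Pdiv.Ring.ltn_rmodpN0 // monic_neq0.
  have /(congr1 (fun p => (map_poly intr p).[a l])) :=
    Pdiv.RingMonic.rdivp_eq fm (q * 'X^i).
  rewrite rmorphD !rmorphM /= map_polyXn !hornerE (eqP (fa l)) mulr0 add0r => <-.
  by rewrite mulrC.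
exists (\det A); move/(congr1 determinant): qV.
rewrite !det_mulmx det_diag det_map_mx [RHS]mulrC => /mulIf ->.
  by apply: eq_bigr => i _; rewrite mxE.
rewrite det_Vandermonde; apply/prodf_neq0 => i _; apply/prodf_neq0 => j ij.
by rewrite !mxE subr_eq0; apply: contraTneq ij => /aI ->; rewrite ltnn.
Qed.

(* The conjugates of q(z) / M are the q(w) / M, so its norm is an integer of
   absolute value < 1. *)
Lemma small_cyclotomic_integer_eq0 (F : numFieldType) n (z : F) (q : {poly int})
    (M : nat) :
  n.-primitive_root z -> (0 < M)%N ->
  integralOver (intr : int -> F) ((map_poly intr q).[z] / M%:R) ->
  (forall w : algC, n.-primitive_root w -> `|(map_poly intr q).[w]| < M%:R) ->
  (map_poly intr q).[z] = 0.
Proof.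
move=> prim_z M_gt0 [f f_monic fz] q_lt.
have n_gt0 := prim_order_gt0 prim_z.
have [w0 prim_w0] := C_prim_root_exists n_gt0.
have horner_ratr (E : numFieldType) (p : {poly int}) (x : E) :
    (map_poly ratr (map_poly intr f \Po (M%:R^-1 *: map_poly intr p))).[x]
      = (map_poly intr f).[(map_poly intr p).[x] / M%:R].
  rewrite map_comp_poly horner_comp map_polyZ !map_ratr_intr hornerZ.
  by rewrite /= fmorphV rmorph_nat mulrC.
(* f composed with q / M is a rational polynomial vanishing at z, hence a multiple of ['Phi_n]; so f
   annihilates q(w) / M for every primitive w. *)
have q_Aint (w : algC) : n.-primitive_root w -> (map_poly intr q).[w] / M%:R \in Aint.
  move=> prim_w; apply: (@root_monic_Aint (map_poly intr f)).
  - have /(Cyclotomic_dvdp prim_z) : root (map_poly ratr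
      (map_poly intr f \Po (M%:R^-1 *: map_poly intr q))) z.
      by rewrite rootE horner_ratr.
    case/dvdpP => h hE; rewrite rootE -horner_ratr hE rmorphM hornerM /=.
    by rewrite map_ratr_intr (eqP (root_Cyclotomic prim_w)) mulr0.
  - exact: monic_map.
  - by apply/polyOverP => i; rewrite coef_map /= intr_int.
pose S := [pred j : 'I_n | coprime j n].
pose a (i : 'I_#|S|) := w0 ^+ enum_val i.
have prim_a i : n.-primitive_root (a i).
  by rewrite prim_root_exp_coprime //; have := enum_valP i.
have S_card : #|S| = totient n.
  rewrite totient_count_coprime -big_mkcond big_mkord -sum1_card.
  by apply: eq_bigl => j; rewrite coprime_sym.
have a_inj : injective a.
  move=> i j /eqP; rewrite (eq_prim_root_expr prim_w0) !modn_small // => /eqP.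
  by move/val_inj/enum_val_inj.
have [N NE] := @prod_horner_roots_int algC _ 'Phi_n q a (Cyclotomic_monic n)
  ltac:(by rewrite S_card size_Cyclotomic) a_inj (fun i => root_Cyclotomic (prim_a i)).
have /existsP[i0 /eqP qa0] : [exists i, (map_poly intr q).[a i] == 0].
  apply: contraT => /existsPn qa.
  pose x := \prod_i ((map_poly intr q).[a i] / M%:R).
  have x_int : x \in Num.int.
    apply: Cint_rat_Aint; last by apply: rpred_prod => i _; apply: q_Aint.
    rewrite /x big_split /= NE rpredM ?rpred_int //.
    by apply: rpred_prod => i _; rewrite rpredV rpred_nat.
  have x0 : x != 0.
    apply/prodf_neq0 => i _; apply: mulf_neq0; first exact: qa.
    by rewrite invr_eq0 pnatr_eq0 -lt0n.
  suff x_lt1 : `|x| < 1.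
    by have := le_lt_trans (norm_intr_ge1 x_int x0) x_lt1; rewrite ltxx.
  rewrite /x normr_prod -[ltRHS](@big1_eq _ _ *%R 'I_#|S| (index_enum _) xpredT).
  apply: ltr_prod => [|i _].
    have S_gt0 : (0 < #|S|)%N by rewrite S_card totient_gt0.
    by apply/hasP; exists (Ordinal S_gt0); rewrite ?mem_index_enum.
  rewrite normr_ge0 normrM normfV normr_nat ltr_pdivrMr ?ltr0n // mul1r.
  exact: q_lt.
(* q vanishes at one primitive root, so ['Phi_n] divides it and it vanishes at z as well. *)
have /(Cyclotomic_dvdp (prim_a i0))/dvdpP[h] :
    root (map_poly ratr (map_poly intr q)) (a i0).
  by rewrite map_ratr_intr; apply/eqP.
move/(congr1 (fun p => (map_poly (ratr : rat -> F) p).[z])).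
rewrite rmorphM hornerM /= !map_ratr_intr (eqP (root_Cyclotomic prim_z)) mulr0.
by [].
Qed.

(** * Palindromicity of cyclotomic polynomials and the equation of z + 1/z *)

Lemma prim_rootV (F : fieldType) n (z : F) :
  n.-primitive_root z -> n.-primitive_root z^-1.
Proof.
move=> prim_z; have n_gt0 := prim_order_gt0 prim_z.
have -> : z^-1 = z ^+ n.-1.
  have z0 : z != 0 by rewrite (prim_root_eq0 prim_z) -lt0n.
  by apply: (mulfI z0); rewrite divff // -exprS prednK ?prim_expr_order.
by rewrite prim_root_exp_coprime // coprime_sym -{1}(prednK n_gt0) coprimeSn.
Qed.

Lemma horner_Cyclotomic n (x : algC) : (map_poly intr 'Phi_n).[x] =
  \sum_(j < (totient n).+1) (('Phi_n)`_j)%:~R * x ^+ j.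
Proof.
rewrite (@horner_coef_wide _ (totient n).+1); last first.
  by rewrite size_map_inj_poly ?size_Cyclotomic //; apply: intr_inj.
by apply: eq_bigr => j _; rewrite coef_map.
Qed.

(* Reversing the coefficients replaces the roots by their inverses, which are the same
   roots; the scalar factor is 1 because 'Phi_n does not vanish at 1. *)
Lemma Cyclotomic_palindrome n i : (2 < n)%N -> (i <= totient n)%N ->
  ('Phi_n)`_(totient n - i) = ('Phi_n)`_i.
Proof.
move=> n_gt2 i_le; set d := totient n.
have [z prim_z] := C_prim_root_exists (ltnW (ltnW n_gt2)).
have z0 : z != 0 by rewrite (prim_root_eq0 prim_z); lia.
pose r := \poly_(j < d.+1) ('Phi_n)`_(d - j).
have horner_Phi := @horner_Cyclotomic n.
have horner_r (x : algC) : (map_poly intr r).[x] =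
    \sum_(j < d.+1) (('Phi_n)`_j)%:~R * x ^+ (d - j).
  rewrite (@horner_coef_wide _ d.+1); last first.
    by apply: leq_trans (size_poly _ _) _; apply: size_poly.
  rewrite (reindex_inj rev_ord_inj); apply: eq_bigr => j _.
  have jd : (j <= d)%N by rewrite -ltnS.
  by rewrite coef_map coef_poly /= subSS ltnS leq_subr subKn.
have : root (map_poly ratr (map_poly intr r)) z.
  rewrite map_ratr_intr rootE horner_r.
  have : root (map_poly (intr : int -> algC) 'Phi_n) z^-1.
    by apply: root_Cyclotomic; rewrite prim_rootV.
  rewrite rootE horner_Phi => /eqP/(congr1 (fun u => z ^+ d * u)).
  rewrite mulr0 mulr_sumr => e; apply/eqP; rewrite -[RHS]e; apply: eq_bigr => j _.
  by rewrite mulrCA exprVn -expfB_cond // (negbTE z0) add0n -ltnS ltn_ord.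
move=> /(Cyclotomic_dvdp prim_z)/dvdpP[s rE].
have size_Phi : size (map_poly (intr : int -> rat) 'Phi_n) = d.+1.
  by rewrite size_map_inj_poly ?size_Cyclotomic //; apply: intr_inj.
have s1 : (size s <= 1)%N.
  have [->|s0] := eqVneq s 0; first by rewrite size_poly0.
  have /(congr1 (fun p : {poly rat} => size p)) := rE.
  rewrite size_mul //; last by rewrite -size_poly_eq0 size_Phi.
  have : (size (map_poly (intr : int -> rat) r) <= d.+1)%N.
    by apply: leq_trans (size_poly _ _) _; apply: size_poly.
  by move=> + e; rewrite e size_Phi addnS /= -add1n leq_add2r.
move: rE; rewrite (size1_polyC s1) mul_polyC => rE.
have Phi1 : (map_poly (intr : int -> algC) 'Phi_n).[1] != 0.
  apply/negP => Phi1; have : root (cyclotomic z n) 1.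
    by rewrite -(Cintr_Cyclotomic prim_z).
  rewrite root_cyclotomic // => /prim_order_dvd/(_ 1%N).
  by rewrite expr1n eqxx dvdn1; lia.
have c1 : s`_0 = 1.
  have /(congr1 (fun p => (map_poly (ratr : rat -> algC) p).[1])) := rE.
  rewrite map_polyZ !map_ratr_intr hornerZ horner_r.
  have -> : \sum_(j < d.+1) (('Phi_n)`_j)%:~R * 1 ^+ (d - j)
      = (map_poly (intr : int -> algC) 'Phi_n).[1].
    by rewrite horner_Phi; apply: eq_bigr => j _; rewrite !expr1n.
  rewrite -{1}[LHS]mul1r => /(mulIf Phi1)/esym/eqP.
  by rewrite fmorph_eq1 => /eqP.
have /(congr1 (fun p : {poly rat} => p`_i)) := rE.
rewrite c1 scale1r !coef_map coef_poly ltnS i_le => /intr_inj.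
by [].
Qed.

(** In odd degree, palindromicity would give ['Phi_n](-1) = - ['Phi_n](-1), so -1 would be a
    primitive n-th root of unity with n > 2. *)
Lemma even_totient n : (2 < n)%N -> ~~ odd (totient n).
Proof.
move=> n_gt2; apply/negP => d_odd; set d := totient n in d_odd.
have [z prim_z] := C_prim_root_exists (ltnW (ltnW n_gt2)).
have horner_Phi := @horner_Cyclotomic n.
have PhiN : (map_poly (intr : int -> algC) 'Phi_n).[-1] = - (map_poly intr 'Phi_n).[-1].
  rewrite {1}horner_Phi (reindex_inj rev_ord_inj) horner_Phi -sumrN.
  apply: eq_bigr => j _; rewrite /= subSS Cyclotomic_palindrome ?leq_ord //.
  rewrite -mulrN; congr (_ * _); rewrite -signr_odd oddB ?leq_ord // d_odd.
  by rewrite -[in RHS]signr_odd; case: (odd j); rewrite /= ?expr0 ?expr1 ?opprK.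
have : root (cyclotomic z n) (-1).
  rewrite -(Cintr_Cyclotomic prim_z) rootE -[_ == 0](mulrn_eq0 _ 2) mulr2n.
  by rewrite {1}PhiN addNr eqxx.
rewrite root_cyclotomic // => /prim_order_dvd/(_ 2%N).
by rewrite sqrrN expr1n eqxx => /dvdn_leq; lia.
Qed.

(** These are 2 T_j(X / 2), with T_j the Chebyshev polynomials of the first kind; they express z^j +
    z^-j through z + z^-1. *)
Fixpoint lucas_poly j : {poly int} :=
  if j is j'.+1 then
    if j' is j''.+1 then 'X * lucas_poly j' - lucas_poly j'' else 'X
  else 2.

Lemma lucas_polySS j : lucas_poly j.+2 = 'X * lucas_poly j.+1 - lucas_poly j.
Proof. by []. Qed.

Lemma horner_lucas_poly (F : fieldType) (z : F) j : z != 0 ->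
  (map_poly intr (lucas_poly j)).[z + z^-1] = z ^+ j + z ^- j.
Proof.
move=> z0; suff [] : (map_poly intr (lucas_poly j)).[z + z^-1] = z ^+ j + z ^- j /\
  (map_poly intr (lucas_poly j.+1)).[z + z^-1] = z ^+ j.+1 + z ^- j.+1 by [].
elim: j => [|j [IH0 IH1]].
  by rewrite /= rmorph_nat map_polyX hornerX hornerMn hornerC expr0 invr1 expr1.
split=> //; rewrite lucas_polySS rmorphB rmorphM /= map_polyX.
rewrite !hornerE IH0 IH1 -!exprVn !exprS.
by move: (z ^+ j) (z^-1 ^+ j) => a b; field.
Qed.

Lemma lucas_poly_monic j : lucas_poly j.+1 \is monic /\ size (lucas_poly j.+1) = j.+2.
Proof.
suff: (lucas_poly j.+1 \is monic /\ size (lucas_poly j.+1) = j.+2) /\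
   (size (lucas_poly j) <= j.+1)%N by case.
elim: j => [|j [[IHm IHs] IH]].
  split; first by rewrite /= monicX size_polyX.
  by rewrite /= -polyC_natr; apply: leq_trans (size_polyC_leq1 _) _.
have X1 : size ('X * lucas_poly j.+1) = j.+3.
  by rewrite mulrC size_mulX ?IHs // monic_neq0.
have sE : size (lucas_poly j.+2) = j.+3.
  by rewrite lucas_polySS size_polyDl X1 // size_polyN (leq_ltn_trans IH).
split; last by rewrite IHs.
split=> //; rewrite lucas_polySS monicE lead_coefDl; last first.
  by rewrite size_polyN X1 (leq_ltn_trans IH).
by rewrite lead_coefM lead_coefX mul1r -monicE.
Qed.

Arguments lucas_poly : simpl never.

(* z^-m 'Phi_n(z), for m half the degree, is symmetric in z and 1/z. *)
Lemma real_cyclotomic_poly n : (2 < n)%N ->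
  exists psi : {poly int}, [/\ psi \is monic, size psi = (totient n)./2.+1 &
    forall (F : fieldType) (z : F), n.-primitive_root z ->
      root (map_poly intr psi) (z + z^-1)].
Proof.
move=> n_gt2; set m := (totient n)./2.
have dE : totient n = (m + m)%N.
  by rewrite addnn -[LHS]odd_double_half (negbTE (even_totient n_gt2)).
have m_gt0 : (0 < m)%N by have := totient_gt0 n; rewrite dE; lia.
pose tail j := \sum_(i < j) ('Phi_n)`_(m + i.+1) *: lucas_poly i.+1.
have tail_size j : (size (tail j) <= j.+1)%N.
  apply: leq_trans (size_sum _ _ _) _; apply/bigmax_leqP => i _.
  apply: leq_trans (size_scale_leq _ _) _.
  by have [_ ->] := lucas_poly_monic i; have := ltn_ord i.
(* With c_j the coefficients of ['Phi_n], this is c_m plus the sum of c_(m+i) [lucas_poly i] for 1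
   <= i <= m; its top term [lucas_poly m] settles degree and leading coefficient. *)
pose psi := (('Phi_n)`_m)%:P + tail m.
have Phi_lead : ('Phi_n)`_(m + m) = 1.
  by have /monicP := Cyclotomic_monic n; rewrite lead_coefE size_Cyclotomic dE.
have psiE : psi = lucas_poly m + ((('Phi_n)`_m)%:P + tail m.-1).
  have -> : psi = (('Phi_n)`_m)%:P + tail m.-1.+1 by rewrite prednK.
  rewrite /tail big_ord_recr /= prednK // Phi_lead scale1r.
  by rewrite [RHS]addrC addrA.
have [lm ls] := lucas_poly_monic m.-1; rewrite prednK // in lm ls.
have rest_size : (size ((('Phi_n)`_m)%:P + tail m.-1)%R < size (lucas_poly m))%N.
  rewrite ls ltnS; apply: leq_trans (size_polyD _ _) _.
  by rewrite geq_max (leq_trans (size_polyC_leq1 _)) // (leq_trans (tail_size _)) ?prednK.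
exists psi; split.
- by rewrite psiE monicE lead_coefDl // -monicE.
- by rewrite psiE size_polyDl // ls.
move=> F z prim_z.
have z0 : z != 0 by rewrite (prim_root_eq0 prim_z); lia.
have : z ^+ m * (map_poly intr psi).[z + z^-1] = (map_poly intr 'Phi_n).[z].
  rewrite rmorphD hornerD /= map_polyC hornerC rmorph_sum horner_sum /=.
  rewrite mulrDr mulr_sumr (@horner_coef_wide _ (m + m.+1)); last first.
    by apply: leq_trans (size_poly _ _) _; rewrite size_Cyclotomic dE addnS.
  (* Splitting at the middle coefficient and reversing the lower half pairs z^(m+i) with z^(m-i),
     whose coefficients agree by palindromicity. *)
  rewrite big_split_ord big_ord_recl /= [X in _ = X + _](reindex_inj rev_ord_inj) /=.
  rewrite addn0 coef_map /= [RHS]addrCA -big_split /=; congr (_ + _).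
    by rewrite mulrC.
  apply: eq_bigr => i _; rewrite map_polyZ hornerZ horner_lucas_poly // !coef_map /=.
  rewrite /bump /= add1n -(@Cyclotomic_palindrome n (m - i.+1)) ?dE //; last by lia.
  have -> : (m + m - (m - i.+1) = m + i.+1)%N by have := ltn_ord i; lia.
  rewrite exprD [z ^+ (m - _)]expfB_cond ?(negbTE z0) ?ltn_ord //; ring.
rewrite (eqP (root_Cyclotomic prim_z)) => /eqP.
by rewrite mulf_eq0 expf_eq0 (negbTE z0) andbF.
Qed.

(** * Faithfulness of the Tits representation *)

Section CoxLength.
Variable k : nat.
Local Notation W := (cox k).
Local Notation s_ := (cox_gen k).
Local Notation l := (@cox_length k).
Implicit Types (w v : W) (s t : 'Z_6).

Lemma cox_length_word (u : seq 'Z_6) : (l (\prod_(i <- u) s_ i)%g <= size u)%N.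
Proof.
rewrite /cox_length; case: ex_minnP => n _; apply.
by apply/asboolP; exists u.
Qed.

Lemma cox_reduced_word w : exists2 u, size u = l w & (\prod_(i <- u) s_ i)%g = w.
Proof.
by rewrite /cox_length; case: ex_minnP => n /asboolP[u [? ?]] _; exists u.
Qed.

Lemma cox_length1 : l 1%g = 0%N.
Proof. by have := cox_length_word [::]; rewrite big_nil leqn0 => /eqP. Qed.

Lemma cox_lengthM w v : (l (w * v)%g <= l w + l v)%N.
Proof.
have [u <- uw] := cox_reduced_word w; have [x <- xv] := cox_reduced_word v.
by rewrite -uw -xv -big_cat -size_cat cox_length_word.
Qed.

Lemma cox_length_gen s : (l (s_ s) <= 1)%N.
Proof. by have := cox_length_word [:: s]; rewrite big_seq1. Qed.

Lemma cox_genK s : (s_ s * s_ s = 1)%g.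
Proof.
have := @cox_gen_relator k [:: s; s]; rewrite !big_cons big_nil mulg1.
by apply; exists s; constructor.
Qed.

Lemma cox_mulgenK w s : (w * s_ s * s_ s = w)%g.
Proof. by rewrite -mulgA cox_genK mulg1. Qed.

Lemma cox_sign_length w : cox_sign w = (-1) ^+ l w.
Proof.
have [u <- <-] := cox_reduced_word w; elim: u => [|i u IHu].
  by rewrite big_nil; exact: (cox_lift1 (@cox_sign_relators k)).
by rewrite big_cons cox_signM cox_sign_gen IHu -exprS.
Qed.

(** A generator changes the length by at most 1, and it does change it because it changes the
    sign. *)
Lemma cox_length_genP w s :
  l (w * s_ s)%g = (l w).+1 \/ l w = (l (w * s_ s)%g).+1.
Proof.
have h1 := cox_lengthM w (s_ s); have h2 := cox_lengthM (w * s_ s)%g (s_ s).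
rewrite cox_mulgenK in h2; have h3 := cox_length_gen s.
have : l (w * s_ s)%g <> l w.
  move=> e; have := cox_signM w (s_ s); rewrite cox_sign_gen !cox_sign_length e.
  by rewrite mulrN1 => /eqP; rewrite -addr_eq0 -mulr2n mulrn_eq0 signr_eq0.
lia.
Qed.

Lemma cox_descent w : w <> 1%g -> exists s, l w = (l (w * s_ s)%g).+1.
Proof.
move=> w1; have [u ul uw] := cox_reduced_word w.
case/lastP: u ul uw => [|u s]; first by rewrite big_nil => _ /esym.
rewrite size_rcons -cats1 big_cat big_seq1 /= => ul uw; exists s.
have := cox_length_genP w s; have := cox_length_word u.
have -> : (\prod_(i <- u) s_ i = w * s_ s)%g by rewrite -uw cox_mulgenK.
lia.
Qed.

(** The alternating product of p letters whose last letter is t. *)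
Fixpoint cox_alt s t p : W :=
  if p is p'.+1 then (cox_alt t s p' * s_ t)%g else 1%g.

Lemma cox_length_alt s t p : (l (cox_alt s t p) <= p)%N.
Proof.
elim: p s t => [|p IHp] s t /=; first by rewrite cox_length1.
have := cox_lengthM (cox_alt t s p) (s_ t); have := IHp t s.
have := cox_length_gen t; lia.
Qed.

Lemma cox_altSl s t p :
  cox_alt s t p.+1 = (s_ (if odd p then s else t) * cox_alt s t p)%g.
Proof.
elim: p s t => [|p IHp] s t; first by rewrite /= mul1g mulg1.
rewrite -[LHS]/(cox_alt t s p.+1 * s_ t)%g IHp -mulgA.
by rewrite -[(cox_alt t s p * s_ t)%g]/(cox_alt s t p.+1) /=; case: (odd p).
Qed.

Lemma cox_alt_add s t q p :
  exists2 g, cox_alt s t (q + p) = (g * cox_alt s t p)%g & (l g <= q)%N.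
Proof.
elim: p s t => [|p IHp] s t.
  by exists (cox_alt s t q); rewrite ?addn0 ?mulg1 ?cox_length_alt.
by have [g gE gl] := IHp t s; exists g; rewrite // addnS /= gE mulgA.
Qed.

Lemma cox_gen_pair_swap s t n : ((s_ t * s_ s) ^+ n = 1 -> (s_ s * s_ t) ^+ n = 1)%g.
Proof.
have -> : (s_ s * s_ t)%g = (s_ t * s_ s)^-1%g.
  by apply: (mulIg (s_ t * s_ s)%g); rewrite mulVg mulgA cox_mulgenK cox_genK.
by rewrite expVgn => ->; rewrite invg1.
Qed.

(** Measures the failure of the braid relation of length p: the two alternating words agree once (s
    t)^p = 1. *)
Lemma cox_alt_swap s t p : cox_alt s t p = (cox_alt t s p * (s_ s * s_ t) ^+ p)%g.
Proof.
elim: p s t => [|p IHp] s t /=; first by rewrite mulg1.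
rewrite IHp -!mulgA; congr (_ * _)%g; rewrite expgS !mulgA cox_genK mul1g.
(* What remains is (t s)^p t = t (s t)^p. *)
elim: p {IHp} => [|p IHp]; first by rewrite !expg0 mul1g mulg1.
by rewrite !expgS -[LHS]mulgA IHp !mulgA.
Qed.

Lemma cox_alt_braid s t m : ((s_ s * s_ t) ^+ m = 1)%g -> cox_alt s t m = cox_alt t s m.
Proof. by move=> st; rewrite cox_alt_swap st mulg1. Qed.

Lemma cox_pair_pow s t n :
  (\prod_(i <- flatten (nseq n [:: s; t])) s_ i = (s_ s * s_ t) ^+ n)%g.
Proof.
elim: n => [|n IHn]; first by rewrite big_nil.
by rewrite /= !big_cons IHn expgS mulgA.
Qed.

Lemma cox_gen1_order s : ((s_ s * s_ (s + 1)%R) ^+ 2 = 1)%g.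
Proof.
rewrite -cox_pair_pow; apply: cox_gen_relator.
by exists s; constructor 2.
Qed.

Lemma cox_gen2_order s : ((s_ s * s_ (s + 2)%R) ^+ k = 1)%g.
Proof.
rewrite -cox_pair_pow; apply: cox_gen_relator.
by exists s; constructor 3.
Qed.

End CoxLength.

(** * Coordinates of the roots of dihedral subgroups *)

Section DihedralCoef.
Variables (R : realType) (k : nat).
Hypothesis k_gt2 : (2 < k)%N.
Local Notation s_ := (cox_gen k).

(** The cases are differences of 1, 2 and 3 up to sign; relators list each pair in one order only,
    so the opposite order goes through [cox_gen_pair_swap]. *)
Lemma gram_pairP (s t : 'Z_6) : s != t ->
  [\/ gram R k s t = 0 /\ ((s_ s * s_ t) ^+ 2 = 1)%g,
      gram R k s t = - 2 * Defs.cosK R k /\ ((s_ s * s_ t) ^+ k = 1)%g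
    | gram R k s t = - 2].
Proof.
rewrite -subr_eq0 => st; rewrite /gram (negbTE st).
have tE : t = s - (s - t) by rewrite opprB addrC subrK.
have sE : s = t + (s - t) by rewrite addrC subrK.
case: ifP => [/orP[]/eqP e|_].
- constructor 1; split=> //; apply: cox_gen_pair_swap.
  by rewrite [in X in (_ * X)%g]sE e cox_gen1_order.
- constructor 1; split=> //.
  by rewrite [in X in (_ * X)%g]tE e opprK cox_gen1_order.
case: ifP => [/orP[]/eqP e|_].
- constructor 2; split=> //; apply: cox_gen_pair_swap.
  by rewrite [in X in (_ * X)%g]sE e cox_gen2_order.
- constructor 2; split=> //.
  by rewrite [in X in (_ * X)%g]tE e opprK cox_gen2_order.
by constructor 3.
Qed.

(** The Chebyshev polynomial of the second kind U_(n-1) at b / 2, that is sin (n x) / sin x when b =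
    2 cos x and sin x is nonzero. *)
Fixpoint dihedral_coef (b : R) n : R :=
  if n is n'.+1 then
    if n' is n''.+1 then b * dihedral_coef b n' - dihedral_coef b n'' else 1
  else 0.

Lemma dihedral_coefSS b n :
  dihedral_coef b n.+2 = b * dihedral_coef b n.+1 - dihedral_coef b n.
Proof. by []. Qed.

Lemma dihedral_coef2 n : dihedral_coef 2 n = n%:R.
Proof.
suff [] : dihedral_coef 2 n = n%:R /\ dihedral_coef 2 n.+1 = n.+1%:R by [].
elim: n => [//|n [IH0 IH1]]; split=> //.
by rewrite dihedral_coefSS IH0 IH1 -!natr1; ring.
Qed.

Lemma dihedral_coef_sin (x : R) n :
  dihedral_coef (2 * cos x) n * sin x = sin (n%:R * x).
Proof.
suff [] : dihedral_coef (2 * cos x) n * sin x = sin (n%:R * x) /\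
  dihedral_coef (2 * cos x) n.+1 * sin x = sin (n.+1%:R * x) by [].
elim: n => [|n [IH0 IH1]]; first by rewrite !mul0r sin0 !mul1r.
split=> //; rewrite dihedral_coefSS mulrBl -!mulrA IH0 IH1.
have -> : n.+2%:R * x = n.+1%:R * x + x by rewrite -natr1 mulrDl mul1r.
have -> : n%:R * x = n.+1%:R * x - x by rewrite -natr1 mulrDl mul1r addrK.
rewrite sinB sinD; ring.
Qed.

Let k_gt0 : (0 : R) < k%:R.
Proof. by rewrite ltr0n; lia. Qed.

Lemma sin_pik_gt0 : 0 < sin (pi / k%:R) :> R.
Proof.
apply: sin_gt0_pi; rewrite divr_gt0 ?pi_gt0 //= ltr_pdivrMr //.
by rewrite ltr_pMr ?pi_gt0 // ltr1n; lia.
Qed.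

Lemma dihedral_coef_cos_ge0 n : (n <= k)%N -> 0 <= dihedral_coef (2 * cospik R k) n.
Proof.
move=> n_le; rewrite -(pmulr_lge0 _ sin_pik_gt0) dihedral_coef_sin.
apply: sin_ge0_pi; rewrite mulr_ge0 ?ler0n ?divr_ge0 ?pi_ge0 //=.
by rewrite mulrCA ler_piMr ?pi_ge0 // ler_pdivrMr // mul1r ler_nat.
Qed.

(** For a pair with (s t)^m = 1, m = 2 or k, the hypothesis gives p + 1 <= m, where the coefficients
    have the sign of sin (n pi / m) >= 0. For form value -2 the n-th coefficient is n. *)
Lemma dihedral_coef_ge0 (s t : 'Z_6) p : s != t ->
  (forall m, (0 < m <= p)%N -> ((s_ s * s_ t) ^+ m <> 1)%g) ->
  0 <= dihedral_coef (- val (gram R k s t)) p /\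
  0 <= dihedral_coef (- val (gram R k s t)) p.+1.
Proof.
move=> st mP; have pP m : (0 < m)%N -> ((s_ s * s_ t) ^+ m = 1)%g -> (p < m)%N.
  by move=> m0 e; rewrite ltnNge; apply/negP => mp; apply: (mP m) => //; rewrite m0.
case: (gram_pairP st) => [[-> /pP]|[-> /pP]|->].
- rewrite rmorph0 oppr0; case: p {mP pP} => [|[|p]] h; last by have := h isT.
    by rewrite /= ler01.
  by rewrite /= ler01 mul0r subr0.
- have -> : - val (- 2 * Defs.cosK R k) = 2 * cospik R k.
    by rewrite rmorphM rmorphN rmorph_nat mulNr opprK.
  by move=> h; split; apply: dihedral_coef_cos_ge0; have := h; lia.
have -> : - val (- 2 : cosfield R k) = 2 by rewrite rmorphN opprK rmorph_nat.
by rewrite !dihedral_coef2 !ler0n.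
Qed.

End DihedralCoef.

(** * Positivity of roots and faithfulness *)

Section Faithful.
Variables (R : realType) (k : nat).
Hypothesis k_gt2 : (2 < k)%N.
Variable alpha : 6.-tuple 'cV[cosfield R k]_6.
Hypothesis alphaP : basis_of fullv alpha.
Local Notation W := (cox k).
Local Notation s_ := (cox_gen k).
Local Notation l := (@cox_length k).
Local Notation V := 'cV[cosfield R k]_6.
Local Notation a_ := (tnth alpha).
Local Notation rho := (tits_rep alpha).

Definition nonneg_vector (v : V) := forall i, 0 <= val (coord alpha i v).

Lemma nonneg_vector_comb (x y : cosfield R k) (u v : V) : 0 <= val x -> 0 <= val y ->
  nonneg_vector u -> nonneg_vector v -> nonneg_vector (x *: u + y *: v).
Proof.
move=> x0 y0 u0 v0 i.
have -> : coord alpha i (x *: u + y *: v) = x * coord alpha i u + y * coord alpha i v.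
  by rewrite linearD !linearZ.
rewrite rmorphD !rmorphM; apply: addr_ge0; apply: mulr_ge0 => //.
- exact: u0.
- exact: v0.
Qed.

Lemma tits_rep_root (s t : 'Z_6) : rho (s_ s) (a_ t) = a_ t - gram R k s t *: a_ s.
Proof. by rewrite tits_rep_gen // tits_form_basis. Qed.

(** Each letter of the alternating word, taken from the right, sends x a_s + y a_t to (b x - y) a_t
    + x a_s: the coordinates run through consecutive values of [dihedral_coef] while s and t swap
    roles. *)
Lemma nonneg_alt (v : W) (s t : 'Z_6) p n (x y : cosfield R k) :
  let b := - val (gram R k s t) in
  nonneg_vector (rho v (a_ s)) -> nonneg_vector (rho v (a_ t)) ->
  0 <= dihedral_coef b (n + p) -> 0 <= dihedral_coef b (n + p).+1 ->
  val x = dihedral_coef b n.+1 -> val y = dihedral_coef b n ->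
  nonneg_vector (rho (v * cox_alt k s t p)%g (x *: a_ s + y *: a_ t)).
Proof.
elim: p s t n x y => [|p IHp] s t n x y b hs ht z0 z1 xE yE.
  rewrite addn0 in z0 z1.
  rewrite /= mulg1 linearD !linearZ /=; apply: nonneg_vector_comb; rewrite ?xE ?yE //.
rewrite /= mulgA tits_repM // comp_lfunE linearD !linearZ /= !tits_rep_root.
rewrite gramii.
have -> : x *: (a_ s - gram R k t s *: a_ t) + y *: (a_ t - 2 *: a_ t)
  = (- gram R k t s * x - y) *: a_ t + x *: a_ s.
  by apply/matrixP => i j; rewrite !mxE; ring.
rewrite addnS -addSn in z0 z1.
apply: (IHp t s n.+1); rewrite ?(gramC _ _ t s) //.
have -> : val (- gram R k s t * x - y) = - val (gram R k s t) * val x - val y.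
  by rewrite rmorphB rmorphM rmorphN.
by rewrite xE yE.
Qed.

(* Split off from w the longest alternating suffix v^-1 w in s and t such that
   l(w) = l(v) + p, where p is its length. Then v sends both roots to nonnegative
   vectors by induction, and p is less than the order of s t, since otherwise the
   braid relation would let the suffix end in s. *)
Lemma tits_root_nonneg (w : W) s :
  l (w * s_ s)%g = (l w).+1 -> nonneg_vector (rho w (a_ s)).
Proof.
have [n] := ubnP (l w); elim: n w s => // n IHn w s /ltnSE wn ws.
have [->|/cox_descent[t wt]] := pselect (w = 1%g).
  move=> i; rewrite tits_rep1 // lfunE.
  have -> : coord alpha i (a_ s) = (s == i)%:R by exact: coord_alpha.
  by rewrite rmorph_nat ler0n.
have st : s != t by apply/eqP => st; move: ws wt; rewrite st; lia.
pose P p := `[< exists2 v, w = (v * cox_alt k s t p)%g & l w = (l v + p)%N >].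
have P1 : P 1%N.
  apply/asboolP; exists (w * s_ t)%g; last by rewrite wt addn1.
  by rewrite /= mul1g cox_mulgenK.
have Pub p : P p -> (p <= l w)%N by move=> /asboolP[v _ ->]; rewrite leq_addl.
case: (ex_maxnP (ex_intro P _ P1) Pub) => p /asboolP[v wE vl] pmax.
have p_gt0 := pmax _ P1.
(* Otherwise this letter could be moved from v to the suffix, against the maximality of p. *)
have v_up : l (v * s_ (if odd p then s else t))%g = (l v).+1.
  have [//|vd] := cox_length_genP v (if odd p then s else t).
  have /pmax : P p.+1; last by rewrite ltnn.
  apply/asboolP; exists (v * s_ (if odd p then s else t))%g.
    by rewrite cox_altSl mulgA cox_mulgenK.
  by rewrite vl vd addSnnS.
(* This is the first letter of the suffix; if it shortened v, then w would be shorter than l(v) +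
   p. *)
have v_up' : l (v * s_ (if odd p.-1 then s else t))%g = (l v).+1.
  have [//|vd] := cox_length_genP v (if odd p.-1 then s else t).
  have := cox_lengthM (v * s_ (if odd p.-1 then s else t))%g (cox_alt k s t p.-1).
  have := cox_length_alt k s t p.-1.
  rewrite -mulgA -cox_altSl prednK // -wE; lia.
have [v_s v_t] : l (v * s_ s)%g = (l v).+1 /\ l (v * s_ t)%g = (l v).+1.
  have p_odd : odd p = ~~ odd p.-1 by rewrite -{1}(prednK p_gt0).
  by move: v_up v_up'; rewrite p_odd; case: (odd p.-1).
have vn : (l v < n)%N by lia.
have m_gt m : (0 < m <= p)%N -> ((s_ s * s_ t) ^+ m <> 1)%g.
  move=> /andP[m_gt0 mp] /cox_alt_braid br.
  have [g gE gl] := cox_alt_add k s t (p - m) m; rewrite subnK // br in gE.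
  rewrite -(prednK m_gt0) /= in gE.
  have := cox_lengthM (v * g)%g (cox_alt k s t m.-1).
  have := cox_lengthM v g; have := cox_length_alt k s t m.-1.
  have -> : (v * g * cox_alt k s t m.-1 = w * s_ s)%g.
    by rewrite wE gE !mulgA cox_mulgenK.
  rewrite ws; lia.
have [z0 z1] := @dihedral_coef_ge0 R k k_gt2 s t p st m_gt.
have := @nonneg_alt v s t p 0 1 0 (IHn v s vn v_s) (IHn v t vn v_t) z0 z1.
by rewrite -wE scale1r scale0r addr0; apply; rewrite ?rmorph1 ?rmorph0.
Qed.

(** If s is a descent of w, then [w * s_ s] sends a_s to a nonnegative vector; but rho(w) = 1 makes
    this vector - a_s. *)
Lemma tits_rep_faithful (w : W) : rho w = (\1)%VF -> w = 1%g.
Proof.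
move=> rw; apply: contrapT => /cox_descent[s ws].
have := @tits_root_nonneg (w * s_ s)%g s; rewrite cox_mulgenK => /(_ ws) /(_ s).
rewrite tits_repM // comp_lfunE rw id_lfunE tits_rep_root gramii.
have -> : coord alpha s (a_ s - 2 *: a_ s) = - 1.
  have -> : a_ s - 2 *: a_ s = - a_ s.
    by rewrite scaler_nat mulr2n opprD addrA subrr sub0r.
  by rewrite linearN /= coord_alpha // eqxx.
rewrite rmorphN1; lra.
Qed.

End Faithful.

(** * The congruence subgroup *)

Section CosIntegers.
Variables (R : realType) (k : nat).
Local Notation K := (cosfield R k).
Implicit Types x y : K.

Lemma cosintD x y : cosint x -> cosint y -> cosint (x + y).
Proof. exact: integral_add. Qed.

Lemma cosintM x y : cosint x -> cosint y -> cosint (x * y).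
Proof. exact: integral_mul. Qed.

Lemma cosintN x : cosint x -> cosint (- x).
Proof. exact: integral_opp. Qed.

Lemma cosint_int (n : int) : cosint (n%:~R : K).
Proof. exact: (integral_id (intr : {rmorphism int -> K})). Qed.

Lemma cosint_sum (I : finType) (F : I -> K) :
  (forall i, cosint (F i)) -> cosint (\sum_i F i).
Proof.
move=> FP; apply: (big_ind (fun x => cosint x)) => //.
- exact: (cosint_int 0).
- exact: cosintD.
Qed.

Lemma cosint_rat (q : rat) x : val x = ratr q -> cosint x -> q \in Num.int.
Proof.
move=> xq [f f_monic fx]; rewrite -Cint_rat; apply: Cint_rat_Aint.
  by apply/CratP; exists q.
apply: (@root_monic_Aint (map_poly intr f)); last 2 first.
- exact: monic_map.
- by apply/polyOverP => i; rewrite coef_map /= intr_int.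
have : root (map_poly intr f) (ratr q : R).
  rewrite -xq; move: fx; rewrite -(fmorph_root (val : {rmorphism K -> R})).
  rewrite -map_poly_comp (@eq_map_poly _ _ _ (intr : int -> R)) // => a.
  exact: (rmorph_int (val : {rmorphism K -> R})).
rewrite -map_ratr_intr fmorph_root.
by rewrite -(fmorph_root (ratr : {rmorphism rat -> algC})) map_ratr_intr.
Qed.

Definition cosintmx (C : 'M[K]_6) := forall i j, cosint (C i j).

Lemma cosintmxD C D : cosintmx C -> cosintmx D -> cosintmx (C + D).
Proof. by move=> CP DP i j; rewrite mxE; apply: cosintD. Qed.

Lemma cosintmxN C : cosintmx C -> cosintmx (- C).
Proof. by move=> CP i j; rewrite mxE; apply: cosintN. Qed.

Lemma cosintmxM C D : cosintmx C -> cosintmx D -> cosintmx (C *m D).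
Proof.
by move=> CP DP i j; rewrite mxE; apply: cosint_sum => l; apply: cosintM.
Qed.

Lemma cosintmxZ x C : cosint x -> cosintmx C -> cosintmx (x *: C).
Proof. by move=> xP CP i j; rewrite mxE; apply: cosintM. Qed.

Lemma cosintmx1 : cosintmx 1%:M.
Proof. by move=> i j; rewrite mxE; apply: (cosint_int (i == j)). Qed.

(** Congruence modulo q between integral elements respects sums and products, hence the Leibniz
    formula. *)
Lemma det_add1_congr q C : cosint q -> cosintmx C ->
  exists2 y, cosint y & \det (1%:M + q *: C) = 1 + q * y.
Proof.
move=> qP CP.
pose cong x y := cosint y /\ exists2 t, cosint t & x = y + q * t.
have congM x y x' y' : cong x y -> cong x' y' -> cong (x * x') (y * y').
  move=> [yP [t tP ->]] [y'P [t' t'P ->]]; split; first exact: cosintM.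
  exists (y * t' + y' * t + q * t * t'); last by ring.
  by do ?[apply: cosintD|apply: cosintM].
have congD x y x' y' : cong x y -> cong x' y' -> cong (x + x') (y + y').
  move=> [yP [t tP ->]] [y'P [t' t'P ->]]; split; first exact: cosintD.
  by exists (t + t'); [exact: cosintD|ring].
have cong_int (n : int) : cong n%:~R n%:~R.
  split; first exact: cosint_int.
  by exists 0; [exact: (cosint_int 0)|rewrite mulr0 addr0].
suff [_ [t tP tE]] : cong (\det (1%:M + q *: C)) (\det (1%:M : 'M[K]_6)).
  by exists t; rewrite // tE det1.
apply: (big_ind2 cong) => [||s _]; [exact: (cong_int 0)|exact: (congD)|].
apply: (congM).
  by have := cong_int ((-1) ^+ s); rewrite rmorphXn rmorphN1.
apply: (big_ind2 cong) => [||i _]; [exact: (cong_int 1)|exact: (congM)|].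
split; first exact: cosintmx1.
by exists (C i (s i)); rewrite // !mxE.
Qed.

Definition gram_mx : 'M[K]_6 := \matrix_(i, j) gram R k i j.

(** The matrix differs from the identity in row i only, with diagonal entry 1 - 2 there, so only the
    identity permutation contributes. *)
Lemma det_reflection (i : 'Z_6) : \det (1%:M - delta_mx i i *m gram_mx) = -1.
Proof.
have E j l : (1%:M - delta_mx i i *m gram_mx) j l
    = (j == l)%:R - (j == i)%:R * gram R k i l.
  rewrite !mxE; congr (_ - _); rewrite (bigD1 (i : 'I_6)) //= big1 => [|m mi].
    by rewrite !mxE eqxx andbT addr0.
  by rewrite !mxE (negbTE mi) andbF mul0r.
rewrite /determinant (bigD1 (1%g : 'S_6)) //= [X in _ + X]big1 => [|s s1].
  rewrite odd_perm1 expr0 mul1r addr0 (bigD1 (i : 'I_6)) //= E perm1 eqxx gramii.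
  rewrite big1 => [|l li]; first by rewrite mulr1 -[LHS]/(1 - 1 * 2); ring.
  by rewrite perm1 E eqxx (negbTE li) mul0r subr0.
(* A nontrivial permutation moves at least two points, one of them different from i. *)
have [l sl li] : exists2 l, s l != l & l != i.
  have [j sj] : exists j, s j != j.
    apply/existsP; apply: contraR s1 => /existsPn sP; apply/eqP/permP => j.
    by rewrite perm1; apply/eqP; have := sP j; rewrite negbK.
  have [ji|ji] := eqVneq j i; last by exists j.
  by exists (s j); rewrite ?(inj_eq perm_inj) -?ji.
by rewrite (bigD1 l) //= E eq_sym (negbTE sl) (negbTE li) mul0r subr0 mul0r mulr0.
Qed.

End CosIntegers.

(** * Matrices of the Tits representation in the basis alpha *)

Section TitsMatrix.
Variables (R : realType) (k : nat).
Hypothesis k_gt2 : (2 < k)%N.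
Variable alpha : 6.-tuple 'cV[cosfield R k]_6.
Hypothesis alphaP : basis_of fullv alpha.
Local Notation K := (cosfield R k).
Local Notation W := (cox k).
Local Notation s_ := (cox_gen k).
Local Notation V := 'cV[K]_6.
Local Notation a_ := (tnth alpha).
Local Notation rho := (tits_rep alpha).
Local Notation G := (gram_mx R k).

Definition basis_mx (f : 'End(V)) : 'M[K]_6 := \matrix_(i, j) coord alpha i (f (a_ j)).

Lemma basis_expand (v : V) : v = \sum_i coord alpha i v *: a_ i.
Proof.
rewrite {1}(coord_basis alphaP (memvf v)); apply: eq_bigr => i _.
by rewrite (tnth_nth 0).
Qed.

Lemma basis_mx_inj : injective basis_mx.
Proof.
move=> f g fg; apply/lfunP => v; rewrite (basis_expand v) !linear_sum.
apply: eq_bigr => j _; rewrite !linearZ; congr (_ *: _).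
rewrite [LHS]basis_expand [RHS]basis_expand; apply: eq_bigr => i _.
by move/matrixP: fg => /(_ i j); rewrite !mxE => ->.
Qed.

Lemma basis_mx1 : basis_mx (\1)%VF = 1%:M.
Proof.
by apply/matrixP => i j; rewrite !mxE id_lfunE coord_alpha // eq_sym.
Qed.

Lemma basis_mxM f g : basis_mx (f \o g)%VF = basis_mx f *m basis_mx g.
Proof.
apply/matrixP => i j; rewrite !mxE comp_lfunE [g _]basis_expand !linear_sum.
by apply: eq_bigr => l _; rewrite !linearZ /= !mxE mulrC.
Qed.

Lemma basis_mxB f g : basis_mx (f - g) = basis_mx f - basis_mx g.
Proof. by apply/matrixP => i j; rewrite !mxE !lfunE /= !lfunE linearB. Qed.

Lemma basis_mxZ c f : basis_mx (c *: f) = c *: basis_mx f.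
Proof. by apply/matrixP => i j; rewrite !mxE scale_lfunE linearZ. Qed.

(** E_(i,j) sends a_l to G_(j,l) a_i, so its matrix is [delta_mx i j *m G]. *)
Lemma basis_mx_E (C : 'I_6 -> 'I_6 -> K) :
  basis_mx (\sum_i \sum_j C i j *: tits_E alpha i j) = (\matrix_(i, j) C i j) *m G.
Proof.
apply/matrixP => i l; rewrite !mxE sum_lfunE linear_sum (bigD1 i) //=.
rewrite [X in _ + X]big1 => [|m mi]; last first.
  rewrite sum_lfunE linear_sum big1 // => j _; rewrite scale_lfunE tits_EE.
  by rewrite !linearZ /= coord_alpha // (negbTE mi) !mulr0.
rewrite addr0 sum_lfunE linear_sum; apply: eq_bigr => j _.
rewrite scale_lfunE tits_EE !linearZ /= coord_alpha // eqxx !mxE.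
by rewrite tits_form_basis // mulr1.
Qed.

Definition tits_mx (w : W) : 'M[K]_6 := basis_mx (rho w).

Lemma tits_mx1 : tits_mx 1%g = 1%:M.
Proof. by rewrite /tits_mx tits_rep1 // basis_mx1. Qed.

Lemma tits_mxM x y : tits_mx (x * y)%g = tits_mx x *m tits_mx y.
Proof. by rewrite /tits_mx tits_repM // basis_mxM. Qed.

Lemma tits_mx_gen (s : 'Z_6) : tits_mx (s_ s) = 1%:M - delta_mx s s *m G.
Proof.
apply/matrixP => i j; rewrite mxE (tits_rep_root k_gt2 alphaP) linearB linearZ /=.
rewrite !coord_alpha // !mxE (bigD1 (s : 'I_6)) //= big1 => [|m ms].
  by rewrite !mxE eqxx andbT addr0 eq_sym (eq_sym i s) mulrC.
by rewrite !mxE (negbTE ms) andbF mul0r.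
Qed.

Lemma det_tits_mx w : \det (tits_mx w) = (cox_sign w)%:~R.
Proof.
have [u _ <-] := cox_reduced_word w; elim: u => [|i u IHu].
  by rewrite big_nil tits_mx1 det1 /cox_sign (cox_lift1 (@cox_sign_relators k)).
rewrite big_cons tits_mxM det_mulmx IHu tits_mx_gen det_reflection.
by rewrite cox_signM cox_sign_gen rmorphM rmorphN1.
Qed.

Lemma tits_congruenceP n w : tits_congruence alpha n w <->
  exists2 C, cosintmx C & tits_mx w = 1%:M + 3 ^+ n *: (C *m G).
Proof.
split=> [[f [c [cP ->]] wE]|[C CP wE]].
  exists (\matrix_(i, j) c i j); first by move=> i j; rewrite mxE.
  rewrite -basis_mx_E -basis_mxZ -wE basis_mxB basis_mx1 addrC subrK //.
exists (\sum_i \sum_j C i j *: tits_E alpha i j); first by exists C.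
apply: basis_mx_inj; rewrite basis_mxB basis_mx1 basis_mxZ basis_mx_E.
rewrite -[basis_mx _]/(tits_mx w) wE addrC addKr; congr (_ *: (_ *m _)).
by apply/matrixP => i j; rewrite mxE.
Qed.

End TitsMatrix.

(** * The ring Z[2 cos (pi / k)] and its conjugates *)

Section CosPoly.
Variables (R : realType) (k : nat).
Hypothesis k_gt2 : (2 < k)%N.
Local Notation K := (cosfield R k).

Definition zeta : R[i] := (cos (pi / k%:R) +i* sin (pi / k%:R))%C.

Lemma zetaX n : zeta ^+ n = (cos (n%:R * (pi / k%:R)) +i* sin (n%:R * (pi / k%:R)))%C.
Proof.
elim: n => [|n IHn]; first by rewrite expr0 !mul0r cos0 sin0.
have e : n.+1%:R * (pi / k%:R) = n%:R * (pi / k%:R) + pi / k%:R :> R.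
  by rewrite -natr1 mulrDl mul1r.
rewrite exprSr IHn e cosD sinD.
by apply/eqP; rewrite eq_complex /=; apply/andP; split; apply/eqP; ring.
Qed.

Let k_neq0 : k%:R != 0 :> R.
Proof. by rewrite pnatr_eq0; lia. Qed.

(** The order m divides 2 k, so m < 2 k would give m <= k; but zeta^m has positive imaginary part
    for 0 < m < k, and zeta^k = -1. *)
Lemma prim_zeta : (2 * k)%N.-primitive_root zeta.
Proof.
have zk : zeta ^+ k = -1.
  rewrite zetaX mulrCA divff // mulr1 cospi sinpi.
  by apply/eqP; rewrite eq_complex /= oppr0 !eqxx.
have z2k : zeta ^+ (2 * k) = 1 by rewrite mulnC exprM zk sqrrN expr1n.
have k2_gt0 : (0 < 2 * k)%N by lia.
have [m prim_m m_dvd] := prim_order_exists k2_gt0 z2k.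
suff <- : m = (2 * k)%N by [].
have m_gt0 := prim_order_gt0 prim_m.
case/dvdnP: m_dvd => q qE; suff q1 : (q < 2)%N by move: qE; case: q q1 => [|[|]] //; lia.
rewrite ltnNge; apply/negP => q2; have mk : (m <= k)%N by nia.
have /eqP := prim_expr_order prim_m.
have [mk'|->] : (m < k)%N \/ m = k by lia.
  rewrite zetaX eq_complex /= => /andP[_ /eqP]; apply/eqP/lt0r_neq0.
  have k0 : 0 < k%:R :> R by rewrite ltr0n; lia.
  apply: sin_gt0_pi; rewrite mulr_gt0 ?ltr0n ?divr_gt0 ?pi_gt0 //=.
  by rewrite mulrCA gtr_pMr ?pi_gt0 // ltr_pdivrMr // mul1r ltr_nat.
by rewrite zk -subr_eq0 -opprD oppr_eq0 -mulr2n pnatr_eq0.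
Qed.

Lemma zeta_addV : zeta + zeta^-1 = (2 * cospik R k)%:C%C.
Proof.
have -> : zeta^-1 = (cos (pi / k%:R) +i* (- sin (pi / k%:R)))%C.
  have z0 : zeta != 0 by rewrite (prim_root_eq0 prim_zeta); lia.
  apply: (mulfI z0); rewrite divff //; apply/eqP; rewrite eq_complex /=.
  have := cos2Dsin2 (pi / k%:R : R); rewrite !expr2 => cs.
  by apply/andP; split; apply/eqP; [rewrite -[LHS]cs|]; ring.
by apply/eqP; rewrite eq_complex /=; apply/andP; split; apply/eqP; rewrite /cospik; ring.
Qed.

Definition cosfield_complex (x : K) : R[i] := (val x)%:C%C.

HB.instance Definition _ := GRing.RMorphism.copy cosfield_complex
  (real_complex R \o (val : K -> R)).

Lemma cosfield_complex_inj : injective cosfield_complex.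
Proof. exact: fmorph_inj. Qed.

Definition cos_eval (p : {poly int}) : K := (map_poly intr p).[2 * Defs.cosK R k].

HB.instance Definition _ := GRing.RMorphism.copy cos_eval
  (horner_eval (2 * Defs.cosK R k) \o map_poly intr).

Lemma cos_eval_complex p :
  cosfield_complex (cos_eval p) = (map_poly intr p).[zeta + zeta^-1].
Proof.
rewrite /cos_eval -horner_map -map_poly_comp /=.
have -> : cosfield_complex (2 * Defs.cosK R k) = zeta + zeta^-1.
  by rewrite zeta_addV rmorphM rmorph_nat /cosfield_complex /= [in RHS]rmorphM rmorph_nat.
congr (_.[_]); apply: eq_map_poly => a; exact: rmorph_int.
Qed.

Lemma cos_eval_poly : exists psi : {poly int},
  [/\ psi \is monic, size psi = (totient (2 * k))./2.+1 & cos_eval psi = 0].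
Proof.
have [|psi [psi_monic psi_size psi0]] := @real_cyclotomic_poly (2 * k); first by lia.
exists psi; split=> //; apply: cosfield_complex_inj.
by rewrite cos_eval_complex rmorph0 (eqP (psi0 _ _ prim_zeta)).
Qed.

Lemma cosint_cos_eval p : cosint (cos_eval p).
Proof.
apply: (@integral_horner _ _ (intr : {rmorphism int -> K})).
  by move=> _ /(nthP 0)[i _ <-]; rewrite coef_map; exact: cosint_int.
have [psi [psi_monic _ psi0]] := cos_eval_poly.
by exists psi; rewrite // rootE -/(cos_eval psi) psi0.
Qed.

(** The conjugates of 2 cos (pi / k) are the w + w^-1 with w a primitive 2k-th root of unity, all of
    absolute value at most 2; this reduces the claim to [small_cyclotomic_integer_eq0]. *)
Lemma cos_eval_small_eq0 (p : {poly int}) (M : nat) x : (0 < M)%N -> cosint x ->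
  cos_eval p = M%:R * x ->
  (forall t : algC, `|t| <= 2 -> `|(map_poly intr p).[t]| < M%:R) -> cos_eval p = 0.
Proof.
move=> M_gt0 xP pE p_lt; apply: cosfield_complex_inj.
rewrite rmorph0 cos_eval_complex.
have expV (F : fieldType) (w : F) : (2 * k)%N.-primitive_root w -> w ^+ (2 * k).-1 = w^-1.
  move=> prim_w; have w0 : w != 0 by rewrite (prim_root_eq0 prim_w); lia.
  apply: (mulfI w0); rewrite divff // -exprS prednK ?prim_expr_order //; lia.
(* The exponent 2 k - 1 stands for -1, which keeps q a polynomial. *)
pose q := p \Po ('X + 'X^((2 * k).-1)).
have qE (F : fieldType) (w : F) : (2 * k)%N.-primitive_root w ->
    (map_poly intr q).[w] = (map_poly intr p).[w + w^-1].
  move=> prim_w; rewrite map_comp_poly horner_comp rmorphD /= map_polyX map_polyXn.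
  by rewrite !hornerE expV.
rewrite -(qE _ _ prim_zeta); apply: (small_cyclotomic_integer_eq0 prim_zeta M_gt0).
  rewrite (qE _ _ prim_zeta) -cos_eval_complex pE rmorphM rmorph_nat mulrC.
  rewrite mulKf; last first.
    by rewrite pnatr_eq0; lia.
  have := integral_rmorph cosfield_complex xP.
  case=> f f_monic fx; exists f => //.
  by rewrite -(@eq_map_poly _ _ (cosfield_complex \o intr)) // => a; exact: rmorph_int.
move=> w prim_w; rewrite (qE _ _ prim_w); apply: p_lt.
have w1 : `|w| = 1.
  apply/eqP; rewrite -(@pexpr_eq1 _ _ (2 * k)) ?normr_ge0 //; last by lia.
  by rewrite -normrX prim_expr_order // normr1.
by rewrite (le_trans (ler_normD _ _)) // normfV w1 invr1.
Qed.

End CosPoly.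

(** * Nondegeneracy of the form *)

Section GramMatrix.
Variables (R : realType) (k : nat).
Hypothesis k_gt2 : (2 < k)%N.
Local Notation K := (cosfield R k).
Local Notation c := (cospik R k).

Lemma cospik_gt0 : 0 < c.
Proof.
have k0 : 0 < k%:R :> R by rewrite ltr0n; lia.
apply: cos_gt0_pihalf; apply/andP; split.
  by rewrite (@lt_le_trans _ _ 0) ?oppr_lt0 ?divr_ge0 ?divr_gt0 ?pi_gt0 ?pi_ge0 // ltW.
by rewrite ltr_pM2l ?pi_gt0 // ltf_pV2 ?posrE // ltr_nat.
Qed.

Lemma cospik_lt1 : c < 1.
Proof.
rewrite -(@ltr_pXn2r _ 2) ?nnegrE ?ler01 ?(ltW cospik_gt0) // expr1n.
by rewrite -[ltRHS](cos2Dsin2 (pi / k%:R)) ltrDl exprn_gt0 ?sin_pik_gt0.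
Qed.

Lemma gramDr (j d : 'Z_6) :
  val (gram R k (j + d) j) = [:: 2; 0; - 2 * c; - 2; - 2 * c; 0]`_d.
Proof.
rewrite /gram addrAC subrr add0r.
have [e0 [e1 e2]] : (val (2 : K) = 2 :> R) /\ (val (- 2 : K) = - 2 :> R) /\
    (val (- 2 * Defs.cosK R k) = - 2 * c :> R).
  by rewrite rmorphM rmorphN rmorph_nat.
have eq0 : val (0 : K) = 0 :> R by rewrite rmorph0.
by case: d => [[|[|[|[|[|[|//]]]]]] ?]; rewrite /=.
Qed.

(** The Gram matrix is circulant, so a row vector it kills is a 6-periodic sequence g satisfying one
    linear recurrence; 0 < c < 1 forces g = 0. *)
Lemma gram_mx_unit : gram_mx R k \in unitmx.
Proof.
rewrite -row_free_unit; apply: inj_row_free => v vG.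
pose g n : R := val (v 0 (n%:R : 'Z_6)).
have g6 n : g n.+4.+2 = g n.
  rewrite /g -[n.+4.+2]/(6 + n)%N addnC natrD; congr (val (v 0 _)).
  have -> : 6%:R = 0 :> 'Z_6 by apply/eqP.
  by rewrite addr0.
have gE n : g n - c * g n.+2 - g n.+3 - c * g n.+4 = 0.
  have /matrixP/(_ 0 (n%:R : 'Z_6)) := vG; rewrite !mxE => /(congr1 val).
  have valM (x y : K) : val (x * y) = val x * val y by exact: rmorphM.
  have valD (x y : K) : val (x + y) = val x + val y by exact: rmorphD.
  have val0 : val (0 : K) = 0 by exact: rmorph0.
  rewrite (big_morph val valD val0) (reindex_inj (addrI (n%:R : 'Z_6))).
  have gd (d : 'Z_6) : val (v 0 (n%:R + d)) = g (n + d)%N by rewrite /g natrD natr_Zp.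
  under eq_bigr do rewrite mxE valM gramDr gd.
  rewrite !big_ord_recl big_ord0 /= /bump /= !addnS !addn0 => e.
  apply: (@mulfI _ 2); first by rewrite pnatr_eq0.
  by rewrite mulr0 -[RHS]e; ring.
have c0 := cospik_gt0; have c1 := cospik_lt1.
have antipodal n : g n.+3 = - g n.
  (* Adding the equations at m and m + 3 leaves c (y_(m+1) + y_(m+2)) = 0; so y alternates in sign
     while having the odd period 3, and vanishes. *)
  pose y m := g m + g m.+3.
  have y1 m : y m.+1 + y m.+2 = 0.
    apply: (mulfI (lt0r_neq0 c0)); rewrite mulr0.
    have := gE m; have := gE m.+3; rewrite /y !g6; lra.
  by have := y1 n.+2; have := y1 n.+3; have := y1 n.+4; rewrite /y !g6; lra.
(* By [antipodal], the equations at n and n + 1 add up to (2 + c) (g_n + g_(n+1)) = 0. *)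
have g1 n : g n.+1 = - g n.
  apply/eqP; rewrite -subr_eq0 opprK; apply/eqP.
  apply: (@mulfI _ (2 + c)); first by rewrite lt0r_neq0 // addr_gt0.
  by have := gE n; have := gE n.+1; rewrite !antipodal; lra.
have g0 n : g n = 0.
  apply: (@mulfI _ (1 - c)); first by rewrite lt0r_neq0 // subr_gt0.
  by have := gE n; rewrite !g1; lra.
apply/matrixP => i j; rewrite ord1 mxE; apply: val_inj.
have := g0 j; rewrite /g natr_Zp => ->.
by symmetry; exact: rmorph0.
Qed.

End GramMatrix.

(** * Coefficient polynomials of words and their size *)

Section WordCoefficients.

Definition gram_poly : 'M[{poly int}]_6 := \matrix_(i, j)
  let d := (i : 'Z_6) - j in
  if d == 0 then 2
  else if (d == 1) || (d == -1) then 0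
  else if (d == 2) || (d == -2) then - 'X
  else - 2.

(* The coefficients of rho(w) - 1 on the E_(i, j), for [w] the product of the
   word, as polynomials in 2 cos (pi / k). *)
Fixpoint word_coef (u : seq 'Z_6) : 'M[{poly int}]_6 :=
  if u is i :: u' then
    word_coef u' - delta_mx i i - delta_mx i i *m gram_poly *m word_coef u'
  else 0.

Lemma map_word_coef_cons (S : nzRingType) (f : {rmorphism {poly int} -> S}) i u :
  map_mx f (word_coef (i :: u)) = map_mx f (word_coef u) - delta_mx i i
    - delta_mx i i *m map_mx f gram_poly *m map_mx f (word_coef u).
Proof. by rewrite /= !map_mxB !map_mxM map_delta_mx. Qed.

Lemma map_gram_poly (R : realType) k :
  map_mx (@cos_eval R k) gram_poly = gram_mx R k.
Proof.
apply/matrixP => i j; rewrite !mxE /gram.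
have e2 : cos_eval R k 2 = 2 by rewrite rmorph_nat.
case: ifP => // _; case: ifP => _; first by rewrite rmorph0.
case: ifP => _; last by rewrite -e2; exact: rmorphN.
have eX : cos_eval R k 'X = 2 * Defs.cosK R k by rewrite /cos_eval map_polyX hornerX.
by rewrite mulNr -eX; exact: rmorphN.
Qed.

Lemma gram_poly_le2 (t : algC) i j : `|t| <= 2 ->
  `|(map_poly intr (gram_poly i j)).[t]| <= 2.
Proof.
move=> t2; rewrite mxE; cbv zeta.
have e2 : (map_poly intr (2 : {poly int})).[t] = 2 by rewrite rmorph_nat hornerMn hornerC.
case: ifP => [_|_]; first by rewrite e2 normr_nat.
case: ifP => _; first by rewrite rmorph0 horner0 normr0 ler0n.
case: ifP => _; rewrite rmorphN hornerN normrN ?e2 ?normr_nat //.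
by rewrite /= map_polyX hornerX.
Qed.

(** Let N be the sum of the absolute values of all entries. A new letter changes row i only: it adds
    at most 1 for the unit entry and 2 N for the product with the Gram row. From N to 3 N + 1, the
    quantity 2 N + 1 at most triples. *)
Lemma word_coef_lt (t : algC) u i j : `|t| <= 2 ->
  `|(map_poly intr (word_coef u i j)).[t]| < (3 ^ size u)%:R.
Proof.
move=> t2; pose e (p : {poly int}) : algC := (map_poly intr p).[t].
have eD p q : e (p + q) = e p + e q by rewrite /e rmorphD hornerD.
have eN p : e (- p) = - e p by rewrite /e rmorphN hornerN.
have eM p q : e (p * q) = e p * e q by rewrite /e rmorphM hornerM.
have e0 : e 0 = 0 by rewrite /e rmorph0 horner0.
have e1 : e 1 = 1 by rewrite /e rmorph1 hornerC.
pose N v := \sum_a \sum_b `|e (word_coef v a b)|.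
have N_ge0 v : 0 <= N v by do 2![apply: sumr_ge0 => ? _].
suff Nle : 2 * N u + 1 <= (3 ^ size u)%:R.
  have ij_le : `|e (word_coef u i j)| <= N u.
    rewrite /N (bigD1 i) //= (bigD1 j) //= -addrA lerDl addr_ge0 //.
      by apply: sumr_ge0 => ? _.
    by do 2![apply: sumr_ge0 => ? _].
  apply: le_lt_trans ij_le _; apply: lt_le_trans Nle.
  by rewrite mulr_natl mulr2n -addrA ltrDl ltr_wpDl.
elim: u {i j} => [|i u IHu].
  rewrite /N big1 ?mulr0 ?add0r // => a _; rewrite big1 // => b _.
  by rewrite mxE e0 normr0.
have rowE a b : (delta_mx i i *m gram_poly *m word_coef u) a b
    = (a == i)%:R * \sum_m gram_poly i m * word_coef u m b.
  rewrite -mulmxA mxE (bigD1 (i : 'I_6)) //= big1 => [|m mi].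
    by rewrite !mxE eqxx andbT addr0.
  by rewrite mxE (negbTE mi) andbF mul0r.
have Nle : N (i :: u) <= N u + 1 + 2 * N u.
  have -> : N u + 1 + 2 * N u = \sum_a \sum_b (`|e (word_coef u a b)|
      + ((a == i) && (b == i))%:R + (a == i)%:R * (2 * \sum_m `|e (word_coef u m b)|)).
    under eq_bigr do rewrite !big_split /=.
    rewrite !big_split /=; congr (_ + _ + _).
      rewrite (bigD1 (i : 'I_6)) //= (bigD1 (i : 'I_6)) //= !eqxx.
      rewrite !big1 ?addr0 // => [a ai|b bi]; last by rewrite (negbTE bi).
      by rewrite big1 // => b _; rewrite (negbTE ai).
    rewrite [RHS](bigD1 (i : 'I_6)) //= [X in _ + X]big1 => [|a ai]; last first.
      by rewrite big1 // => b _; rewrite (negbTE ai) mul0r.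
    rewrite addr0 eqxx; under [RHS]eq_bigr do rewrite mul1r.
    by rewrite -mulr_sumr exchange_big.
  apply: ler_sum => a _; apply: ler_sum => b _.
  have subE (A B : 'M[{poly int}]_6) : (A - B) a b = A a b - B a b by rewrite !mxE.
  rewrite /= !subE rowE [delta_mx i i a b]mxE !eD !eN.
  apply: le_trans (ler_normB _ _) _; apply: lerD.
    apply: le_trans (ler_normB _ _) _; apply: lerD => //.
    by case: (_ && _); rewrite /= ?e1 ?e0 ?normr1 ?normr0.
  rewrite eM normrM.
  case: (a == i); rewrite /= ?e1 ?e0 ?normr1 ?normr0 ?mul0r // !mul1r.
  rewrite (big_morph e eD e0); apply: le_trans (ler_norm_sum _ _ _) _.
  rewrite mulr_sumr; apply: ler_sum => m _; rewrite eM normrM ler_wpM2r //.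
  exact: gram_poly_le2.
apply: le_trans (_ : 2 * (N u + 1 + 2 * N u) + 1 <= _); first by rewrite lerD2r ler_pM2l.
rewrite /= expnS natrM.
have -> : 2 * (N u + 1 + 2 * N u) + 1 = 3%:R * (2 * N u + 1) by ring.
by rewrite ler_pM2l ?ltr0n.
Qed.

End WordCoefficients.

(** f may vary inside a coset, so a coset is coded by the value of f at a chosen representative; the
    hypothesis makes this code injective. *)
Lemma card_left_cosets (G : groupType) (H : set G) (T : finType) (f : G -> T) :
  normal_subgroup H -> (forall x y, f x = f y -> H (y^-1 * x)%g) ->
  left_cosets H #<= `I_#|T|.
Proof.
move=> [H1 HM HV _] fP.
pose rep (A : set G) := xget 1%g [set g | [set (g * h)%g | h in H] = A].
have repP A : left_cosets H A -> [set (rep A * h)%g | h in H] = A.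
  move=> [g _ gA].
  by apply: (@xgetPex _ 1%g [set g | [set (g * h)%g | h in H] = A]); exists g.
have sub x y : f x = f y -> [set (x * h)%g | h in H] `<=` [set (y * h)%g | h in H].
  move=> xy _ [h hH <-]; exists (y^-1 * x * h)%g; last by rewrite !mulgA mulgV mul1g.
  by apply: HM hH; apply: fP.
pose code A : nat := enum_rank (f (rep A)).
have code_inj : {in left_cosets H &, injective code}.
  move=> A B /set_mem AH /set_mem BH /val_inj/enum_rank_inj e.
  by rewrite -(repP A AH) -(repP B BH); apply/seteqP; split; apply: sub.
apply: (@card_le_trans _ _ _ (code @` left_cosets H)).
  by have := inj_card_eq code_inj; rewrite card_eq_le => /andP[].
by apply: subset_card_le => _ [A _ <-] /=; rewrite /code.
Qed.

(** * Matrix identities for products, inverses and conjugates of 1 + q C G *)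

Section CongruenceMatrix.
Variables (F : comNzRingType) (n : nat) (q : F).
Implicit Types A B C D G : 'M[F]_n.

Lemma reflection_mulmx C D G :
  (1%:M - D *m G) *m (1%:M + C *m G) = 1%:M + (C - D - D *m G *m C) *m G.
Proof.
rewrite mulmxDr mulmx1 !mulmxBl mul1mx !mulmxA.
by rewrite -!addrA; congr (_ + _); rewrite addrCA.
Qed.

Lemma congruence_mulmx C D G :
  (1%:M + q *: (C *m G)) *m (1%:M + q *: (D *m G))
    = 1%:M + q *: ((C + D + q *: (C *m G *m D)) *m G).
Proof.
rewrite mulmxDr mulmx1 mulmxDl mul1mx -!addrA; congr (_ + _).
by rewrite !mulmxDl !scalerDr -!scalemxAl -!scalemxAr !mulmxA.
Qed.

(** The first equation reads A = 1 - q A C G, and A C = C + D G C. *)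
Lemma congruence_invmx A C D G :
  A *m (1%:M + q *: (C *m G)) = 1%:M -> A = 1%:M + D *m G ->
  A = 1%:M + q *: (- (C + D *m G *m C) *m G).
Proof.
move=> AV AE; move: AV; rewrite mulmxDr mulmx1 -scalemxAr {2}AE => e.
apply/eqP; rewrite -(inj_eq (addIr (q *: ((1%:M + D *m G) *m (C *m G))))) e.
by rewrite mulmxDl mul1mx mulNmx scalerN !mulmxA mulmxDl subrK.
Qed.

Lemma congruence_conjmx A B C D D' G :
  A *m B = 1%:M -> A = 1%:M + D' *m G -> B = 1%:M + D *m G ->
  A *m ((1%:M + q *: (C *m G)) *m B)
    = 1%:M + q *: ((1%:M + D' *m G) *m C *m (1%:M + G *m D) *m G).
Proof.
move=> AB AE BE; rewrite mulmxDl mul1mx mulmxDr AB; congr (_ + _).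
rewrite -scalemxAl -scalemxAr AE BE; congr (_ *: _).
rewrite -!mulmxA; congr (_ *m (_ *m _)).
by rewrite mulmxDr mulmxDl mulmx1 mul1mx mulmxA.
Qed.

End CongruenceMatrix.

(** * Normality, evenness, intersection with the ball, and index *)

Section Congruence.
Variables (R : realType) (k : nat).
Hypothesis k_gt2 : (2 < k)%N.
Variable alpha : 6.-tuple 'cV[cosfield R k]_6.
Hypothesis alphaP : basis_of fullv alpha.
Local Notation K := (cosfield R k).
Local Notation W := (cox k).
Local Notation s_ := (cox_gen k).
Local Notation G := (gram_mx R k).
Local Notation N := (tits_mx alpha).
Local Notation ev := (@cos_eval R k).
Local Notation H := (tits_congruence alpha).

Lemma tits_mx_word u :
  N (\prod_(i <- u) s_ i)%g = 1%:M + map_mx ev (word_coef u) *m G.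
Proof.
elim: u => [|i u IHu]; first by rewrite big_nil tits_mx1 // map_mx0 mul0mx addr0.
rewrite big_cons (tits_mxM k_gt2 alphaP) IHu (tits_mx_gen k_gt2 alphaP).
rewrite map_word_coef_cons map_gram_poly.
exact: reflection_mulmx.
Qed.

Lemma cosintmx_map_eval C : cosintmx (map_mx ev C).
Proof. by move=> i j; rewrite mxE; apply: cosint_cos_eval. Qed.

Lemma cosintmx_gram : cosintmx G.
Proof. by rewrite -map_gram_poly; apply: cosintmx_map_eval. Qed.

Lemma tits_mx_int (w : W) : exists2 C, cosintmx C & N w = 1%:M + C *m G.
Proof.
have [u _ <-] := cox_reduced_word w; rewrite tits_mx_word.
by exists (map_mx ev (word_coef u)) => //; apply: cosintmx_map_eval.
Qed.

Lemma cosint3X n : cosint (3 ^+ n : K).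
Proof. by have := @cosint_int R k (3 ^+ n); rewrite rmorphXn rmorph_nat. Qed.

Lemma tits_congruence_normal n : normal_subgroup (H n).
Proof.
have VK (x : W) : N x^-1%g *m N x = 1%:M.
  by rewrite -(tits_mxM k_gt2 alphaP) mulVg tits_mx1.
have gP := cosintmx_gram; have qP := cosint3X n.
split.
- apply/tits_congruenceP => //; exists 0.
    by move=> i j; rewrite mxE; apply: (cosint_int R k 0).
  by rewrite tits_mx1 // mul0mx scaler0 addr0.
- move=> x y /(tits_congruenceP alphaP)[C CP xE].
  move=> /(tits_congruenceP alphaP)[D DP yE].
  apply/tits_congruenceP => //; exists (C + D + 3 ^+ n *: (C *m G *m D)).
    by do ?[apply: cosintmxD|apply: cosintmxM|apply: cosintmxZ].
  by rewrite (tits_mxM k_gt2 alphaP) xE yE; exact: congruence_mulmx.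
- move=> x /(tits_congruenceP alphaP)[C CP xE].
  have [D DP xVE] := tits_mx_int x^-1%g.
  apply/tits_congruenceP => //; exists (- (C + D *m G *m C)).
    by do ?[apply: cosintmxN|apply: cosintmxD|apply: cosintmxM].
  by apply: congruence_invmx xVE; rewrite -xE.
- move=> g x /(tits_congruenceP alphaP)[C CP xE].
  have [D DP gE] := tits_mx_int g; have [D' D'P gVE] := tits_mx_int g^-1%g.
  apply/tits_congruenceP => //; exists ((1%:M + D' *m G) *m C *m (1%:M + G *m D)).
    by do ?[apply: cosintmxD|apply: cosintmxM|apply: cosintmx1].
  by rewrite conjgE !(tits_mxM k_gt2 alphaP) xE; apply: congruence_conjmx.
Qed.

Lemma tits_congruence_even n : (0 < n)%N -> H n `<=` cox_even k.
Proof.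
move=> n_gt0 w /(tits_congruenceP alphaP)[C CP wE]; rewrite /cox_even /=.
have signE : cox_sign w = (-1) ^+ odd (cox_length w).
  by rewrite cox_sign_length signr_odd.
have [y yP e] : exists2 y : K, cosint y & (cox_sign w)%:~R = 1 + 3 ^+ n * y.
  rewrite -(det_tits_mx k_gt2 alphaP) wE; apply: det_add1_congr; first exact: cosint3X.
  by apply: cosintmxM => //; apply: cosintmx_gram.
have qE : 3 ^+ n = 3 * 3 ^+ n.-1 :> K by rewrite -exprS prednK.
move: e; rewrite qE -mulrA; set z := 3 ^+ n.-1 * y; rewrite signE.
(* A sign -1 would give -1 = 1 + 3 z, making z = -2/3 an algebraic integer. *)
case: odd => //= e.
have zP : cosint z by apply: cosintM => //; apply: cosint3X.
have : (- (2 / 3) : rat) \in Num.int.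
  apply: (cosint_rat (x := z)) => //.
  have /(congr1 val) : (-1 : K) = 1 + 3 * z by rewrite -e rmorphXn rmorphN1.
  have -> : val (1 + 3 * z) = 1 + 3 * val z.
    by rewrite rmorphD rmorphM rmorph1 rmorph_nat.
  have -> : val (-1 : K) = -1 by rewrite rmorphN rmorph1.
  have -> : ratr (- (2 / 3)) = - (2 / 3) :> R by rewrite rmorphN fmorph_div !rmorph_nat.
  lra.
case/intrP => m mE; have : (-2)%:~R = (3 * m)%:~R :> rat.
  by rewrite rmorphM /= -mE; field.
by move/intr_inj; lia.
Qed.

Lemma tits_congruence_ball n : cox_ball k n `&` H n = [set 1%g].
Proof.
apply/seteqP; split=> [w [/= wl wH]|w ->]; last first.
  by split; [rewrite /cox_ball /= cox_length1|have [] := tits_congruence_normal n].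
apply: (tits_rep_faithful k_gt2 alphaP); apply: (basis_mx_inj alphaP).
rewrite basis_mx1 // -[basis_mx _ _]/(N w).
move: wH => /(tits_congruenceP alphaP)[C CP].
have [u ul <-] := cox_reduced_word w; rewrite tits_mx_word => /addrI.
(* G can be cancelled, so the coefficient matrix of the word is itself 3^n times an integral
   matrix. *)
have G_free : row_free G by rewrite row_free_unit gram_mx_unit.
rewrite scalemxAl => /(row_free_inj G_free) CE.
suff -> : map_mx ev (word_coef u) = 0 by rewrite mul0mx addr0.
apply/matrixP => i j; rewrite !mxE.
have ijE : ev (word_coef u i j) = (3 ^ n)%:R * C i j.
  by have /matrixP/(_ i j) := CE; rewrite !mxE natrX.
apply: (cos_eval_small_eq0 k_gt2 _ (CP i j) ijE); first by rewrite expn_gt0.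
move=> t t2; apply: lt_le_trans (word_coef_lt u i j t2) _.
by rewrite ler_nat leq_exp2l // ul.
Qed.

(** Multiplying on the left by the matrix of y^-1, which is 1 plus an integral matrix times G, keeps
    the difference of the form 3^n C' G. *)
Lemma tits_congruenceVM n (x y : W) C : cosintmx C ->
  N x = N y + 3 ^+ n *: (C *m G) -> H n (y^-1 * x)%g.
Proof.
move=> CP xE; have [D DP yE] := tits_mx_int y^-1%g.
apply/(tits_congruenceP alphaP); exists ((1%:M + D *m G) *m C).
  apply: cosintmxM => //; apply: cosintmxD; first exact: cosintmx1.
  by apply: cosintmxM => //; apply: cosintmx_gram.
rewrite (tits_mxM k_gt2 alphaP) xE mulmxDr -(tits_mxM k_gt2 alphaP) mulVg.
by rewrite (tits_mx1 k_gt2 alphaP) -scalemxAr yE mulmxA.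
Qed.

Lemma cos_eval_rmodp (psi p : {poly int}) : psi \is monic -> ev psi = 0 ->
  ev (Pdiv.Ring.rmodp p psi) = ev p.
Proof.
move=> psi_monic psi0; rewrite [in RHS](Pdiv.RingMonic.rdivp_eq psi_monic p).
by rewrite rmorphD rmorphM /= psi0 mulr0 add0r.
Qed.

Lemma cos_eval_congr (r r' : {poly int}) m (q : int) :
  (size r <= m)%N -> (size r' <= m)%N ->
  (forall j, (j < m)%N -> (r`_j = r'`_j %[mod q])%Z) ->
  exists s, ev r = ev r' + q%:~R * ev s.
Proof.
move=> r_size r'_size rr'; pose s := \poly_(j < m) ((r`_j - r'`_j) %/ q)%Z.
exists s; have -> : r = r' + q%:P * s.
  apply/polyP => j; rewrite coefD coefCM coef_poly; case: ltnP => jm.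
    have /divzK e : (q %| r`_j - r'`_j)%Z.
      by rewrite -eqz_mod_dvd; apply/eqP; apply: rr'.
    by rewrite [q * _]mulrC e addrC subrK.
  by rewrite !nth_default ?mulr0 ?addr0 // (leq_trans _ jm).
have evC : ev q%:P = q%:~R by rewrite /cos_eval map_polyC hornerC.
by rewrite rmorphD rmorphM /= evC.
Qed.

Lemma card_cosets_tits_congruence n :
  left_cosets (H n) #<= `I_((3 ^ n) ^ (6 * 6 * (totient (2 * k))./2))%N.
Proof.
have [psi [psi_monic psi_size psi0]] := @cos_eval_poly R k k_gt2.
set m := (totient _)./2 in psi_size *.
have q_gt0 : (0 < 3 ^ n)%N by rewrite expn_gt0.
(* Reduction modulo psi leaves m integer coefficients in each of the 36 entries and keeps their
   value at 2 cos (pi / k). *)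
pose coef (w : W) i j := Pdiv.Ring.rmodp (word_coef (repr w) i j) psi.
have coef_size w i j : (size (coef w i j) <= m)%N.
  by rewrite -ltnS -psi_size Pdiv.Ring.ltn_rmodpN0 // monic_neq0.
pose residue (x : int) : 'I_(3 ^ n).-1.+1 := inord `|(x %% (3 ^ n)%N)%Z|%N.
have residueP x y : residue x = residue y -> (x = y %[mod (3 ^ n)%N])%Z.
  have q0 : (3 ^ n)%N%:Z != 0 by rewrite eqz_nat -lt0n.
  have lt z : (`|(z %% (3 ^ n)%N)%Z| < (3 ^ n).-1.+1)%N.
    by rewrite prednK // -ltz_nat gez0_abs ?modz_ge0 // ltz_pmod.
  move=> /(congr1 val); rewrite /= !inordK // => e.
  by rewrite -(gez0_abs (modz_ge0 x q0)) -(gez0_abs (modz_ge0 y q0)) e.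
pose code (w : W) : {ffun 'I_6 * 'I_6 * 'I_m -> 'I_(3 ^ n).-1.+1} :=
  [ffun t : 'I_6 * 'I_6 * 'I_m => residue (coef w t.1.1 t.1.2)`_t.2].
have NE (w : W) : N w = 1%:M + map_mx ev (word_coef (repr w)) *m G.
  by rewrite -{1}(cox_ofK w) -cox_word_prod tits_mx_word.
have <- : #|{ffun 'I_6 * 'I_6 * 'I_m -> 'I_(3 ^ n).-1.+1}| = ((3 ^ n) ^ (6 * 6 * m))%N.
  by rewrite card_ffun !card_prod !card_ord prednK.
apply: (card_left_cosets (f := code)) => [|x y xy].
  exact: tits_congruence_normal.
have /choice[s sE] : forall ij : 'I_6 * 'I_6, exists s,
    ev (word_coef (repr x) ij.1 ij.2) = ev (word_coef (repr y) ij.1 ij.2) + 3 ^+ n * ev s.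
  move=> [i j] /=; rewrite -(cos_eval_rmodp (word_coef (repr x) i j) psi_monic psi0).
  rewrite -(cos_eval_rmodp (word_coef (repr y) i j) psi_monic psi0).
  have -> : 3 ^+ n = (3 ^ n)%N%:~R :> K by rewrite -pmulrn natrX.
  apply: (@cos_eval_congr _ _ m); [exact: coef_size|exact: coef_size|move=> l lm].
  apply: residueP; move/ffunP: xy => /(_ (i, j, Ordinal lm)).
  by rewrite !ffunE.
apply: (@tits_congruenceVM n x y (\matrix_(i, j) ev (s (i, j)))).
  by move=> i j; rewrite mxE; apply: cosint_cos_eval.
rewrite !NE -addrA scalemxAl -mulmxDl; congr (_ + _ *m _).
by apply/matrixP => i j; rewrite !mxE (sE (i, j)).
Qed.

End Congruence.

Theorem proposition22 (R : realType) (k : nat) (k_ge3 : (3 <= k)%N)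
    (alpha : 6.-tuple 'cV[cosfield R k]_6) (alpha_basis : basis_of fullv alpha) :
  let H := tits_congruence alpha (4 * k)%N in
  [/\ normal_subgroup H,
      H `<=` cox_even k,
      cox_ball k (4 * k)%N `&` H = [set 1%g]
    & left_cosets H #<= `I_(3 ^ (72 * k * totient (2 * k)))%N].
Proof.
split.
- exact: tits_congruence_normal.
- by apply: tits_congruence_even => //; lia.
- exact: tits_congruence_ball.
have := card_cosets_tits_congruence k_ge3 alpha_basis (4 * k).
rewrite -expnM; suff -> : (4 * k * (6 * 6 * (totient (2 * k))./2) =
  72 * k * totient (2 * k))%N by [].
(* With phi(2k) = 2 m, the exponent 4 k * 36 * m becomes 72 k phi(2k). *)
have /even_totient even : (2 < 2 * k)%N by lia.
rewrite -[in RHS](odd_double_half (totient _)) (negbTE even); lia.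
Qed.
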